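(* Let $f_1,f_2,f_3,f_4:\mathbb{R}^+\to\mathbb{R}^+$ be strongly hyperbolic functions. Let $\mathcal{C}:=\mathcal{C}^-(f_1,f_2)\cup\mathcal{C}^+(f_3,f_4)$. Then $\mathcal{M}(f_1,f_2;f_3,f_4):=(\mathcal{P},\mathcal{C})$, with $(+)$-parallel classes the verticals $\{x_0\}\times\mathbb{S}^1$ and $(-)$-parallel classes the horizontals $\mathbb{S}^1\times\{y_0\}$, is a flat Minkowski plane.
   Context: Identify $\mathbb{S}^1$ with $\mathbb{R}\cup\{\infty\}$ (one-point compactification) and let $\mathcal{P}=\mathbb{S}^1\times\mathbb{S}^1$; $\mathbb{R}^+=(0,\infty)$. Two points are $(+)$-parallel if they have the same first coordinate, $(-)$-parallel if they have the same second coordinate, and parallel if either holds. A flat Minkowski plane is a geometry with point set $\mathcal{P}$, whose circles are graphs of homeomorphisms of $\mathbb{S}^1$, whose $(+)$-parallel classes are the verticals and $(-)$-parallel classes the horizontals, satisfying: (Joining) any three pairwise nonparallel points lie on a unique circle; (Touching) for each circle $C$ and nonparallel points $p\in C$, $q\notin C$, there is exactly one circle $D$ with $p,q\in D$ and $C\cap D=\{p\}$. A function $f:\mathbb{R}^+\to\mathbb{R}^+$ is strongly hyperbolic if: (1) $\lim_{x\to0+}f(x)=+\infty$ and $\lim_{x\to+\infty}f(x)=0$; (2) $f$ is strictly convex; (3) for each $b\in\mathbb{R}$, $\lim_{x\to+\infty}f(x+b)/f(x)=1$; (4) $f$ is differentiable; (5) $x\mapsto\ln|f'(x)|$ is strictly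 convex. For strongly hyperbolic $f_1,f_2$ and $a>0$, $b,c\in\mathbb{R}$, define $f_{a,b,c}:\mathbb{R}\setminus\{-b\}\to\mathbb{R}\setminus\{c\}$ by $f_{a,b,c}(x)=af_1(x+b)+c$ for $x>-b$ and $f_{a,b,c}(x)=-af_2(-x-b)+c$ for $x<-b$. Let $\overline{f_{a,b,c}}=\{(x,f_{a,b,c}(x)):x\neq-b\}\cup\{(-b,\infty),(\infty,c)\}$ and, for $s,t\in\mathbb{R}$, $\overline{l_{s,t}}=\{(x,sx+t):x\in\mathbb{R}\}\cup\{(\infty,\infty)\}$. Define $\mathcal{C}^-(f_1,f_2)=\{\overline{f_{a,b,c}}:a>0,b,c\in\mathbb{R}\}\cup\{\overline{l_{s,t}}:s<0,t\in\mathbb{R}\}$, and $\mathcal{C}^+(f_1,f_2)=\varphi(\mathcal{C}^-(f_1,f_2))$ (image of each set), where $\varphi(x,y)=(-x,y)$ with $-\infty=\infty$. *)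

(* Defs.v *)
From Stdlib Require Import Reals.
Open Scope R_scope.

(* S^1 = R ∪ {∞}: [Some x] is the real x, [None] is ∞. *)
Definition S1 := option R.
Definition Pt := (S1 * S1)%type.

(* Topology of the one-point compactification. *)
Definition S1_open (U : S1 -> Prop) : Prop :=
  (forall x, U (Some x) -> exists eps, 0 < eps /\
      forall y, Rabs (y - x) < eps -> U (Some y)) /\
  (U None -> exists M, forall y, M < Rabs y -> U (Some y)).

Definition S1_continuous (g : S1 -> S1) : Prop :=
  forall U, S1_open U -> S1_open (fun z => U (g z)).

Definition S1_homeomorphism (g : S1 -> S1) : Prop :=
  exists h : S1 -> S1,
    (forall z, h (g z) = z) /\ (forall z, g (h z) = z) /\
    S1_continuous g /\ S1_continuous h.

Definition same_set (A B : Pt -> Prop) : Prop := forall p, A p <-> B p.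

Definition plus_parallel (p q : Pt) : Prop := fst p = fst q.
Definition minus_parallel (p q : Pt) : Prop := snd p = snd q.
Definition parallel (p q : Pt) : Prop := plus_parallel p q \/ minus_parallel p q.

Definition is_homeo_graph (C : Pt -> Prop) : Prop :=
  exists g, S1_homeomorphism g /\ forall p, C p <-> snd p = g (fst p).

(* Flat Minkowski plane on point set P = S^1 x S^1 with verticals as
   (+)-parallel classes and horizontals as (-)-parallel classes; the
   geometry is determined by its family of circles [Cs]. *)
Definition flat_minkowski_plane (Cs : (Pt -> Prop) -> Prop) : Prop :=
  (forall C, Cs C -> is_homeo_graph C) /\
  (forall p q r, ~ parallel p q -> ~ parallel p r -> ~ parallel q r ->
     exists C, Cs C /\ C p /\ C q /\ C r /\
       forall D, Cs D -> D p -> D q -> D r -> same_set D C) /\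
  (forall C p q, Cs C -> C p -> ~ C q -> ~ parallel p q ->
     exists D, Cs D /\ D p /\ D q /\ (forall z, C z /\ D z <-> z = p) /\
       forall E, Cs E -> E p -> E q -> (forall z, C z /\ E z <-> z = p) ->
         same_set E D).

(* Strongly hyperbolic functions R^+ -> R^+ (f given on R, only values on
   (0,+oo) matter). *)
Definition strictly_convex_pos (g : R -> R) : Prop :=
  forall x y t, 0 < x -> 0 < y -> x <> y -> 0 < t < 1 ->
    g (t * x + (1 - t) * y) < t * g x + (1 - t) * g y.

Definition strongly_hyperbolic (f : R -> R) : Prop :=
  (forall x, 0 < x -> 0 < f x) /\
  (forall M, exists d, 0 < d /\ forall x, 0 < x < d -> M < f x) /\
  (forall eps, 0 < eps -> exists N, forall x, N < x -> Rabs (f x) < eps) /\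
  strictly_convex_pos f /\
  (forall b eps, 0 < eps -> exists N, forall x, N < x ->
      Rabs (f (x + b) / f x - 1) < eps) /\
  (exists df : R -> R,
      (forall x, 0 < x -> derivable_pt_lim f x (df x)) /\
      strictly_convex_pos (fun x => ln (Rabs (df x)))).

Definition fabc (f1 f2 : R -> R) (a b c x : R) : R :=
  if Rlt_dec (- b) x then a * f1 (x + b) + c else - a * f2 (- x - b) + c.

Definition fbar (f1 f2 : R -> R) (a b c : R) (p : Pt) : Prop :=
  match p with
  | (Some x, Some y) => x <> - b /\ y = fabc f1 f2 a b c x
  | (Some x, None) => x = - b
  | (None, Some y) => y = c
  | (None, None) => False
  end.

Definition lbar (s t : R) (p : Pt) : Prop :=
  match p with
  | (Some x, Some y) => y = s * x + t
  | (None, None) => True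
  | _ => False
  end.

Definition Cminus (f1 f2 : R -> R) (D : Pt -> Prop) : Prop :=
  (exists a b c, 0 < a /\ same_set D (fbar f1 f2 a b c)) \/
  (exists s t, s < 0 /\ same_set D (lbar s t)).

Definition negS1 (z : S1) : S1 :=
  match z with Some x => Some (- x) | None => None end.

Definition phi (p : Pt) : Pt := (negS1 (fst p), snd p).

Definition Cplus (f1 f2 : R -> R) (D : Pt -> Prop) : Prop :=
  exists E, Cminus f1 f2 E /\ same_set D (fun p => exists q, E q /\ p = phi q).

(* Main.v *)
(* Put [d = - f']. Strict convexity of [ln d] means that [d (x + e) / d x] increases strictly in [x] for [e > 0], and
   condition (3) makes it tend to 1; all monotonicity statements about [f] needed below follow from this.

   A circle of [Cminus] reverses the cyclic order of [S^1] and one of [Cplus] preserves it, so the cyclic order of the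
   coordinates of three points decides which family can join them, and the reflection [phi] exchanges the two families.
   Within [Cminus] the joining circle is found by solving one equation for the pole parameter [b], both sides of which have
   a ratio that is strictly monotone in [b] and has the right limits.

   For touching, move the common point to infinity by charts [-1/u] on both coordinate circles: two circles become
   continuous bijections of the line, which meet by the intermediate value theorem as soon as their difference changes sign.
   So circles touching at a finite point have the same slope there, and circles touching at a point at infinity have the same
   scale [a]. Conversely the circles of [Cminus] with a given slope at a finite point [p] partition the points not parallel
   to [p]: again one equation for [b] with monotone ratio. *)
Require Import Defs.
From Stdlib Require Import Reals Lra Classical IndefiniteDescription.
Open Scope R_scope.

(** * Strongly hyperbolic functions *)

(** For a fixed pole and fixed arms the conditions on a circle of [Cminus] are affine in [a] and
    [c], so these two are eliminated and one equation in [b] remains; uniqueness of the circle is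
    uniqueness of the root. The two sides of that equation often move in the same direction, so
    their difference need not be monotone; this is why ratios are compared. The comparisons are kept
    as products: inserting the equation at two roots [b < b'] turns a strict inequality into an
    equality. The partition by slope does double duty for touching. A second common point of two
    circles of equal slope would lie on two members of the partition, so no local estimate of how
    tangent circles separate is made. The crossing lemmas are stated for arbitrary homeomorphisms of
    the circle, so the same lemmas show that circles of different families never touch: their slopes
    at a finite common point have opposite signs. *)

Record sh (f d : R -> R) : Prop := {
  sh_pos : forall x, 0 < x -> 0 < f x;
  sh_dpos : forall x, 0 < x -> 0 < d x;
  sh_der : forall x, 0 < x -> derivable_pt_lim f x (- d x);
  sh_zero : forall M, exists e, 0 < e /\ forall x, 0 < x < e -> M < f x;
  sh_infty : forall e, 0 < e -> exists N, forall x, N < x -> 0 < x -> f x < e;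
  sh_tan : forall x y, 0 < x -> 0 < y -> x <> y -> f x - d x * (y - x) < f y;
  sh_ratio : forall h m, 0 < h -> m < 1 ->
    exists N, forall x, N < x -> 0 < x -> m * f x < f (x + h);
  sh_logconvex : forall x y h, 0 < x -> x < y -> 0 < h ->
    d (x + h) * d y < d x * d (y + h) }.

(** A point [z] below the tangent would drag the chord from [x], and by convexity the difference
    quotients at [x] in that direction, away from [l] by at least the fixed amount [e]. This gives
    the weak inequality; strictness is gained at the midpoint of [x] and [y]. *)
Lemma convex_tangent (f : R -> R) x y l :
  strictly_convex_pos f -> 0 < x -> 0 < y -> x <> y ->
  derivable_pt_lim f x l -> f x + l * (y - x) < f y.
Proof.
intros Hc Hx Hy Hxy Hl.
assert (weak : forall z, 0 < z -> z <> x -> f x + l * (z - x) <= f z).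
{ intros z Hz Hzx.
  destruct (Rle_lt_dec (f x + l * (z - x)) (f z)) as [H|H]; auto. exfalso.
  set (e := (f x + l * (z - x) - f z) / Rabs (z - x)).
  assert (Hab : 0 < Rabs (z - x)) by (apply Rabs_pos_lt; lra).
  assert (He : 0 < e) by (apply Rdiv_lt_0_compat; lra).
  destruct (Hl e He) as [[del Hdel] H1]; simpl in H1.
  set (t := Rmin (1/2) (del / (2 * Rabs (z - x)))).
  assert (Hq : 0 < del / (2 * Rabs (z - x))) by (apply Rdiv_lt_0_compat; lra).
  assert (Ht : 0 < t <= 1/2 /\ t <= del / (2 * Rabs (z - x))).
  { unfold t; split; [split|]. apply Rmin_pos; lra. apply Rmin_l. apply Rmin_r. }
  assert (Ht2 : t * Rabs (z - x) <= del / 2).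
  { apply Rle_trans with (del / (2 * Rabs (z - x)) * Rabs (z - x)).
    apply Rmult_le_compat_r; lra. right; field; lra. }
  assert (Hne : t * (z - x) <> 0) by (apply Rmult_integral_contrapositive; lra).
  specialize (H1 (t * (z - x)) Hne).
  rewrite Rabs_mult, (Rabs_pos_eq t) in H1 by lra.
  specialize (H1 ltac:(lra)).
  assert (H2 := Hc z x t Hz Hx Hzx ltac:(lra)).
  replace (t * z + (1 - t) * x) with (x + t * (z - x)) in H2 by ring.
  set (D := f (x + t * (z - x)) - f x) in *.
  assert (H3 : Rabs (D - l * (t * (z - x))) < t * (e * Rabs (z - x))).
  { replace (D - l * (t * (z - x))) with ((D / (t * (z - x)) - l) * (t * (z - x)))
      by (field; lra).
    rewrite Rabs_mult, (Rabs_mult t), (Rabs_pos_eq t) by lra.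
    replace (t * (e * Rabs (z - x))) with (e * (t * Rabs (z - x))) by ring.
    apply Rmult_lt_compat_r; auto. apply Rmult_lt_0_compat; lra. }
  assert (H4 : e * Rabs (z - x) = f x + l * (z - x) - f z)
    by (unfold e; field; lra).
  rewrite H4 in H3. apply Rabs_def2 in H3.
  unfold D in *. nra. }
assert (H := Hc x y (1/2) Hx Hy Hxy ltac:(lra)).
replace (1/2 * x + (1 - 1/2) * y) with ((x + y) / 2) in H by field.
assert (W := weak ((x + y) / 2) ltac:(lra) ltac:(lra)). lra.
Qed.

Lemma strongly_hyperbolic_sh f : strongly_hyperbolic f -> exists d, sh f d.
Proof.
intros (Hp & Hz & Hi & Hc & Hr & df & Hd & Hl).
assert (Htan : forall x y, 0 < x -> 0 < y -> x <> y -> f x + df x * (y - x) < f y)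
  by (intros; apply convex_tangent; auto).
(* With a nonnegative slope at [x] the tangent would keep [f] above [f x] from there on, against the
   limit 0. *)
assert (Hneg : forall x, 0 < x -> df x < 0).
{ intros x Hx. destruct (Rlt_le_dec (df x) 0) as [H|H]; auto. exfalso.
  destruct (Hi (f x) (Hp x Hx)) as [N HN].
  set (y := Rmax N x + 1).
  assert (N <= Rmax N x) by apply Rmax_l.
  assert (x <= Rmax N x) by apply Rmax_r.
  specialize (HN y ltac:(unfold y; lra)). apply Rabs_def2 in HN.
  specialize (Htan x y Hx ltac:(unfold y; lra) ltac:(unfold y; lra)).
  assert (0 <= df x * (y - x)) by (apply Rmult_le_pos; unfold y; lra). lra. }
exists (fun x => - df x). constructor; auto.
- intros x Hx. specialize (Hneg x Hx). lra.
- intros x Hx. rewrite Ropp_involutive. auto.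
- intros e He. destruct (Hi e He) as [N HN]. exists N. intros x Hx _.
  specialize (HN x Hx). apply Rabs_def2 in HN. lra.
- intros x y Hx Hy Hxy. specialize (Htan x y Hx Hy Hxy). lra.
- intros h m Hh Hm. destruct (Hr h (1 - m) ltac:(lra)) as [N HN]. exists N.
  intros x Hx Hx0. specialize (HN x Hx). apply Rabs_def2 in HN.
  assert (0 < f x) by auto.
  replace (f (x + h)) with (f (x + h) / f x * f x) by (field; lra).
  apply Rmult_lt_compat_r; lra.
- intros x y h Hx Hxy Hh.
  assert (E : forall z, 0 < z -> - df z = exp (ln (Rabs (df z)))).
  { intros z Hz'. specialize (Hneg z Hz').
    rewrite exp_ln; rewrite Rabs_left; lra. }
  rewrite !E, <- !exp_plus by lra.
  apply exp_increasing.
  (* The points [x + h] and [y] divide the segment from [x] to [y + h] with weights [t] and [1 - t]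
     in opposite order; the sum of the two convexity inequalities is the claim in logarithms. *)
  assert (T : 0 < h / (y + h - x) < 1).
  { split. apply Rdiv_lt_0_compat; lra.
    apply Rmult_lt_reg_r with (y + h - x). lra.
    replace (h / (y + h - x) * (y + h - x)) with h by (field; lra). lra. }
  set (t := h / (y + h - x)) in *.
  assert (A := Hl (y + h) x t ltac:(lra) Hx ltac:(lra) T).
  assert (B := Hl x (y + h) t Hx ltac:(lra) ltac:(lra) T).
  cbv beta in A, B.
  replace (t * (y + h) + (1 - t) * x) with (x + h) in A by (unfold t; field; lra).
  replace (t * x + (1 - t) * (y + h)) with y in B by (unfold t; field; lra).
  lra.
Qed.

Lemma sh_decr f d : sh f d -> forall x y, 0 < x -> x < y -> f y < f x.
Proof.
intros H x y Hx Hxy.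
assert (T := sh_tan _ _ H y x ltac:(lra) Hx ltac:(lra)).
assert (D := sh_dpos _ _ H y ltac:(lra)). nra.
Qed.

Lemma sh_inj f d : sh f d -> forall x y, 0 < x -> 0 < y -> f x = f y -> x = y.
Proof.
intros H x y Hx Hy E. destruct (Rtotal_order x y) as [L|[L|L]]; auto.
- assert (T := sh_decr _ _ H x y Hx L). lra.
- assert (T := sh_decr _ _ H y x Hy L). lra.
Qed.

Lemma sh_d_decr f d : sh f d -> forall x y, 0 < x -> x < y -> d y < d x.
Proof.
intros H x y Hx Hxy.
assert (T := sh_tan _ _ H x y Hx ltac:(lra) ltac:(lra)).
assert (T' := sh_tan _ _ H y x ltac:(lra) Hx ltac:(lra)). nra.
Qed.

Lemma sh_cont f d : sh f d -> forall x, 0 < x -> continuity_pt f x.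
Proof.
intros H x Hx. apply derivable_continuous_pt.
exists (- d x). apply sh_der; auto.
Qed.

Lemma continuity_pt_eps f x :
  (forall e, 0 < e -> exists del, 0 < del /\
     forall y, Rabs (y - x) < del -> Rabs (f y - f x) < e) -> continuity_pt f x.
Proof.
intros H e He. destruct (H e He) as (del & Hd & Hy).
exists del. split; auto. intros y [_ Hyx]. apply Hy, Hyx.
Qed.

(* The tangents at [y] near [x], evaluated at [x + h] and [x - h], pinch [d y] between difference quotients of [f] at [x]. *)
Lemma sh_d_cont f d : sh f d -> forall x, 0 < x -> continuity_pt d x.
Proof.
intros H x Hx. apply continuity_pt_eps. intros e He.
destruct (sh_der _ _ H x Hx (e / 2) ltac:(lra)) as [[del Hdel] H1]; simpl in H1.
set (h := Rmin (del / 2) (x / 2)).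
assert (Hh : 0 < h /\ h <= del / 2 /\ h <= x / 2).
{ unfold h; split; [|split]. apply Rmin_pos; lra. apply Rmin_l. apply Rmin_r. }
clearbody h.
assert (A := H1 h ltac:(lra)). rewrite Rabs_pos_eq in A by lra. specialize (A ltac:(lra)).
assert (B := H1 (- h) ltac:(lra)). rewrite Rabs_Ropp, Rabs_pos_eq in B by lra. specialize (B ltac:(lra)).
apply Rabs_def2 in A. apply Rabs_def2 in B.
set (q1 := (f (x + h) - f x) / h) in *.
set (q2 := (f (x + - h) - f x) / - h) in *.
assert (Q1 : f (x + h) = f x + q1 * h) by (unfold q1; field; lra).
assert (Q2 : f (x + - h) = f x - q2 * h) by (unfold q2; field; lra).
clearbody q1 q2.
assert (C0 : continuity_pt f x) by (eapply sh_cont; eauto).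
destruct (C0 (e * h / 8) ltac:(nra)) as (r & Hr & HR).
assert (C : forall y, Rabs (y - x) < r -> Rabs (f y - f x) < e * h / 8).
{ intros y Hy. destruct (Req_dec x y) as [->|N].
  - rewrite Rminus_diag, Rabs_R0. nra.
  - apply HR. split; [split|]; [exact I|exact N|exact Hy]. }
(* [r] keeps [f y] within [e * h / 8] of [f x]. The other radius is [w * h / 2], where
   [w * (Rabs (d x) + e + 1) <= e / 8] makes the error of moving the base point from [x] to [y]
   small against [e * h]. *)
exists (Rmin r (h / 2 * Rmin 1 (e / (8 * (Rabs (d x) + e + 1))))).
assert (HB : 0 < e / (8 * (Rabs (d x) + e + 1))).
{ apply Rdiv_lt_0_compat; auto. assert (P := Rabs_pos (d x)). lra. }
set (w := Rmin 1 (e / (8 * (Rabs (d x) + e + 1)))).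
assert (Hw : 0 < w /\ w <= 1 /\ w * (Rabs (d x) + e + 1) <= e / 8).
{ unfold w. split; [|split]. apply Rmin_pos; lra. apply Rmin_l.
  assert (P := Rabs_pos (d x)).
  apply Rle_trans with (e / (8 * (Rabs (d x) + e + 1)) * (Rabs (d x) + e + 1)).
  apply Rmult_le_compat_r. lra. apply Rmin_r. right; field. lra. }
clearbody w. split. apply Rmin_pos; nra.
intros y Hy.
assert (Y1 := Rlt_le_trans _ _ _ Hy (Rmin_l _ _)).
assert (Y2 := Rlt_le_trans _ _ _ Hy (Rmin_r _ _)).
specialize (C y Y1). apply Rabs_def2 in C. apply Rabs_def2 in Y2.
rewrite (Rabs_pos_eq (d x)) in Hw by (left; apply (sh_dpos _ _ H); auto).
assert (Dx := sh_dpos _ _ H x Hx).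
assert (y0 : 0 < y) by nra.
assert (Dy := sh_dpos _ _ H y y0).
assert (T1 := sh_tan _ _ H y (x + h) y0 ltac:(lra) ltac:(nra)).
assert (T2 := sh_tan _ _ H y (x + - h) y0 ltac:(lra) ltac:(nra)).
apply Rabs_def1.
- apply Rnot_le_lt; intro K.
  assert (d y * (h - w * h / 2) <= d y * (y - (x + - h))) by (apply Rmult_le_compat_l; nra).
  assert ((d x + e) * (h - w*h/2) <= d y * (h - w*h/2)) by (apply Rmult_le_compat_r; nra).
  nra.
- apply Rnot_le_lt; intro K.
  assert (d y * ((x + h) - y) <= d y * (h + w * h / 2)) by (apply Rmult_le_compat_l; nra).
  assert (d y * (h + w*h/2) <= (d x - e) * (h + w*h/2)) by (apply Rmult_le_compat_r; nra).
  nra.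
Qed.

Lemma sh_der_comb f d : sh f d -> forall p q e z, 0 < e -> 0 < z ->
  derivable_pt_lim (fun z => p * f (z + e) - q * f z) z (p * - d (z + e) - q * - d z).
Proof.
intros H p q e z He Hz.
apply (derivable_pt_lim_minus (fun z => p * f (z + e)) (fun z => q * f z)).
- replace (p * - d (z + e)) with (p * (- d (z + e) * (1 + 0))) by ring.
  apply derivable_pt_lim_scal.
  apply (derivable_pt_lim_comp (fun z => z + e) f).
  + apply (derivable_pt_lim_plus (fun z => z) (fun _ => e)).
    apply derivable_pt_lim_id. apply derivable_pt_lim_const.
  + apply (sh_der _ _ H). lra.
- apply derivable_pt_lim_scal. apply (sh_der _ _ H); auto.
Qed.

(* [t |-> f (t + e) - (d (v + e) / d v) * f t] has its strict maximum at [t = v], since [t |-> d (t + e) / d t] increases. *)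
Lemma sh_shift_max f d : sh f d -> forall v t e, 0 < v -> 0 < t -> t <> v -> 0 < e ->
  (f (t + e) - f (v + e)) * d v < d (v + e) * (f t - f v).
Proof.
intros H v t e Hv Ht Htv He.
assert (Dk := fun z Hz => sh_der_comb _ _ H (d v) (d (v + e)) e z He Hz).
destruct (Rtotal_order t v) as [L|[L|L]]; try lra.
- destruct (MVT_cor2 _ _ t v L (fun c Hc => Dk c ltac:(lra))) as (c & Hc & Hc').
  assert (K := sh_logconvex _ _ H c v e ltac:(lra) ltac:(lra) He). nra.
- destruct (MVT_cor2 _ _ v t L (fun c Hc => Dk c ltac:(lra))) as (c & Hc & Hc').
  assert (K := sh_logconvex _ _ H v c e Hv ltac:(lra) He). nra.
Qed.

(** This is [sh_shift_max] at [v = u] in the limit of infinite [t], where [f t] and [f (t + e)]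
    vanish. The work lies in keeping the inequality strict. *)
Lemma sh_quot_incr f d : sh f d -> forall u e, 0 < u -> 0 < e ->
  d (u + e) * f u < f (u + e) * d u.
Proof.
intros H u e Hu He.
assert (A := sh_shift_max _ _ H u (u + 1) e Hu ltac:(lra) ltac:(lra) He).
apply Rnot_le_lt; intro K.
assert (D1 := sh_dpos _ _ H u Hu).
assert (D2 := sh_dpos _ _ H (u + e) ltac:(lra)).
(* Beyond [u + 1] the defect [g0] in [sh_shift_max] cannot shrink, while [f] tends to 0. *)
set (g0 := d (u + e) * (f (u+1) - f u) - (f (u + 1 + e) - f (u + e)) * d u) in *.
assert (G0 : 0 < g0) by (unfold g0; lra).
assert (Hr : 0 < g0 / (d (u + e))) by (apply Rdiv_lt_0_compat; auto).
destruct (sh_infty _ _ H _ Hr) as [N HN].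
set (t := Rmax N (u + 1) + 1).
assert (N <= Rmax N (u+1)) by apply Rmax_l.
assert (u + 1 <= Rmax N (u+1)) by apply Rmax_r.
assert (Ht : f t < g0 / d (u + e)) by (apply HN; unfold t; lra).
assert (Ht' : d (u + e) * f t < g0).
{ apply Rmult_lt_compat_r with (r := d (u + e)) in Ht; auto.
  replace (g0 / d (u + e) * d (u + e)) with g0 in Ht by (field; lra). lra. }
assert (P := sh_pos _ _ H (t + e) ltac:(unfold t; lra)).
assert (B := sh_shift_max _ _ H (u + 1) t e ltac:(lra) ltac:(unfold t; lra) ltac:(unfold t; lra) He).
assert (C := sh_logconvex _ _ H u (u + 1) e Hu ltac:(lra) He).
assert (D3 := sh_dpos _ _ H (u + 1) ltac:(lra)).
assert (M := sh_decr _ _ H (u + 1) t ltac:(lra) ltac:(unfold t; lra)).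
assert (M' := sh_decr _ _ H (u + 1 + e) (t + e) ltac:(lra) ltac:(unfold t; lra)).
(* In the bound at [u + 1] the ratio of derivatives is replaced by the smaller one at [u]; it says
   that the defect grows from [u + 1] to [t]. *)
assert (E : d (u + e) * (f (u + 1) - f t) < (f (u + 1 + e) - f (t + e)) * d u).
{ apply Rmult_lt_reg_r with (d (u + 1)); auto.
  apply Rlt_trans with (d u * d (u + 1 + e) * (f (u+1) - f t)).
  - replace (d (u + e) * (f (u + 1) - f t) * d (u + 1)) with
      ((d (u + e) * d (u + 1)) * (f (u + 1) - f t)) by ring.
    apply Rmult_lt_compat_r; lra.
  - assert (X : d (u+1+e) * (f (u+1) - f t) < (f (u+1+e) - f (t+e)) * d (u+1)) by lra.
    apply Rmult_lt_compat_l with (r := d u) in X; auto. lra. }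
unfold g0 in *. nra.
Qed.

(** The logarithmic derivative of [f (x + e) / f x] is [d x / f x - d (x + e) / f (x + e)], positive
    by [sh_quot_incr]. Instead of differentiating, [sh_shift_max] at [x + h] bounds [f (x + e)], and
    [sh_quot_incr] at the same point exchanges the ratio of derivatives for the ratio of values. *)
Lemma sh_ratio_incr f d : sh f d -> forall x e h, 0 < x -> 0 < e -> 0 < h ->
  f (x + h) * f (x + e) < f x * f (x + h + e).
Proof.
intros H x e h Hx He Hh.
assert (A := sh_shift_max _ _ H (x + h) x e ltac:(lra) Hx ltac:(lra) He).
assert (B := sh_quot_incr _ _ H (x + h) e ltac:(lra) He).
assert (D := sh_dpos _ _ H (x + h) ltac:(lra)).
assert (P := sh_pos _ _ H (x + h) ltac:(lra)).
assert (M := sh_decr _ _ H x (x + h) Hx ltac:(lra)).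
apply Rmult_lt_reg_r with (d (x + h)); auto.
assert (X : f (x + e) * d (x + h) < f (x + h + e) * d (x + h) + d (x + h + e) * (f x - f (x + h))) by lra.
apply Rmult_lt_compat_l with (r := f (x + h)) in X; auto.
assert (Y : f (x + h) * (d (x + h + e)) * (f x - f (x + h)) < f (x+h+e) * d (x+h) * (f x - f (x+h))).
{ apply Rmult_lt_compat_r; lra. }
lra.
Qed.

Lemma sh_drop_lt f d : sh f d -> forall x y, 0 < x -> x < y -> f x - f y < d x * (y - x).
Proof. intros H x y Hx Hy. assert (T := sh_tan _ _ H x y Hx ltac:(lra) ltac:(lra)). lra. Qed.

Lemma sh_drop_gt f d : sh f d -> forall x y, 0 < x -> x < y -> d y * (y - x) < f x - f y.
Proof. intros H x y Hx Hy. assert (T := sh_tan _ _ H y x ltac:(lra) Hx ltac:(lra)). lra. Qed.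

(** The limit passes from [f] to [d] by the mean value theorem: [f (z + h) - m * f z] is positive at
    [N] and smaller at a distant [M], so its derivative is negative at some [c] between them. The
    monotone ratio [d (x + h) / d x] carries the resulting bound to all larger [x]. *)
Lemma sh_d_ratio f d : sh f d -> forall h m, 0 < h -> m < 1 ->
  exists N, 0 < N /\ forall x, N <= x -> m * d x < d (x + h).
Proof.
intros H h m0 Hh Hm0.
(* A nonnegative [m] makes [f (M + h) - m * f M] at most [f (M + h)]. *)
set (m := Rmax m0 0).
assert (Hm : m < 1) by (apply Rmax_lub_lt; lra).
assert (m0 <= m) by apply Rmax_l.
assert (0 <= m) by apply Rmax_r.
destruct (sh_ratio _ _ H h m Hh Hm) as [N0 HN].
set (N := Rmax N0 1 + 1).
assert (N0 <= Rmax N0 1) by apply Rmax_l.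
assert (1 <= Rmax N0 1) by apply Rmax_r.
specialize (HN N ltac:(unfold N; lra) ltac:(unfold N; lra)).
assert (N1 : 0 < N) by (unfold N; lra). clearbody N m.
destruct (sh_infty _ _ H (f (N + h) - m * f N) ltac:(lra)) as [N' HN'].
set (M := Rmax N N' + 1).
assert (N <= Rmax N N') by apply Rmax_l.
assert (N' <= Rmax N N') by apply Rmax_r.
specialize (HN' (M + h) ltac:(unfold M; lra) ltac:(unfold M; lra)).
assert (HM : N < M) by (unfold M; lra). clearbody M.
destruct (MVT_cor2 _ _ N M HM (fun c Hc => sh_der_comb _ _ H 1 m h c Hh ltac:(lra)))
  as (c & E & Hc).
assert (PM := sh_pos _ _ H M ltac:(lra)).
assert (Kc : m * d c < d (c + h)) by nra.
exists c. split. lra. intros x Hx.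
assert (Dc := sh_dpos _ _ H c ltac:(lra)).
assert (Dx := sh_dpos _ _ H x ltac:(lra)).
apply Rle_lt_trans with (m * d x). apply Rmult_le_compat_r; lra.
destruct Hx as [Hx | <-]; auto.
assert (L := sh_logconvex _ _ H c x h ltac:(lra) Hx Hh).
apply Rmult_lt_reg_r with (d c); auto.
apply Rmult_lt_compat_r with (r := d x) in Kc; auto. lra.
Qed.

Lemma sh_quot_zero f d : sh f d -> forall m, 0 < m ->
  exists e, 0 < e /\ forall b, 0 < b < e -> f b < m * d b.
Proof.
intros H m Hm.
(* This bound makes [f b - f 1], hence [d b], exceed [2 / m * f (m / 2)], so [f (m / 2)] is at most
   half of [m * d b]. The drop of [f] over a length [m / 2] supplies the other half. *)
destruct (sh_zero _ _ H (2 / m * f (m / 2) + f 1)) as (e & He & HE).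
assert (M1 := Rmin_l e 1). assert (M2 := Rmin_r e 1).
exists (Rmin e 1). split. apply Rmin_pos; lra.
intros b Hb. specialize (HE b ltac:(lra)).
assert (A := sh_drop_lt _ _ H b 1 ltac:(lra) ltac:(lra)).
assert (B := sh_drop_lt _ _ H b (b + m / 2) ltac:(lra) ltac:(lra)).
assert (C := sh_decr _ _ H (m / 2) (b + m / 2) ltac:(lra) ltac:(lra)).
assert (D := sh_dpos _ _ H b ltac:(lra)).
assert (E : 2 / m * f (m / 2) < d b) by nra.
apply Rmult_lt_compat_l with (r := m / 2) in E; [|lra].
replace (m / 2 * (2 / m * f (m / 2))) with (f (m / 2)) in E by (field; lra).
lra.
Qed.

Lemma sh_quot_infty f d : sh f d -> forall m, exists b, 0 < b /\ m * d b < f b.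
Proof.
intros H m.
set (k := Rmax m 0 + 1).
assert (m <= Rmax m 0) by apply Rmax_l.
assert (0 <= Rmax m 0) by apply Rmax_r.
(* Over a length [2 * k] on which [d] loses less than half of its value, [f] drops by more than
   [k * d b]. *)
destruct (sh_d_ratio _ _ H (2 * k) (1/2) ltac:(unfold k; lra) ltac:(lra)) as (b & Hb & HB).
specialize (HB b ltac:(lra)). exists b. split; auto.
assert (D := sh_dpos _ _ H b Hb).
assert (A := sh_drop_gt _ _ H b (b + 2 * k) Hb ltac:(unfold k; lra)).
assert (P := sh_pos _ _ H (b + 2 * k) ltac:(unfold k; lra)).
unfold k in *. nra.
Qed.

Lemma ivt_strict (F : R -> R) u v :
  (forall x, Rmin u v <= x <= Rmax u v -> continuity_pt F x) ->
  F u < 0 -> 0 < F v -> exists x, Rmin u v < x < Rmax u v /\ F x = 0.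
Proof.
intros HC Hu Hv.
assert (W : exists x, Rmin u v <= x <= Rmax u v /\ F x = 0).
{ destruct (Rtotal_order u v) as [L|[L|L]].
  - rewrite Rmin_left, Rmax_right in * by lra.
    destruct (Ranalysis5.IVT_interv F u v HC L Hu Hv) as (x & Hx & E). eauto.
  - subst. lra.
  - rewrite Rmin_right, Rmax_left in * by lra.
    assert (HC' : forall x, v <= x <= u -> continuity_pt (- F)%F x)
      by (intros; apply continuity_pt_opp; auto).
    destruct (Ranalysis5.IVT_interv (- F)%F v u HC' L) as (x & Hx & E);
      unfold opp_fct in *; try lra.
    exists x. split; auto. lra. }
destruct W as (x & Hx & E). exists x. split; auto.
revert Hx. unfold Rmin, Rmax. destruct (Rle_dec u v); intros;
  (assert (x <> u) by (intros ->; lra)); (assert (x <> v) by (intros ->; lra)); lra.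
Qed.

(** The domain is a convex predicate and [u], [v] come in either order, since below the sign changes
    in both directions on open intervals and half-lines. *)
Lemma ivt_interval (F : R -> R) (P : R -> Prop) u v :
  (forall x y z, P x -> P y -> x <= z <= y -> P z) ->
  (forall x, P x -> continuity_pt F x) -> P u -> P v ->
  F u < 0 -> 0 < F v -> exists x, P x /\ F x = 0.
Proof.
intros Hconv HC Pu Pv Fu Fv.
assert (K : forall x, Rmin u v <= x <= Rmax u v -> P x).
{ intros x. unfold Rmin, Rmax. destruct (Rle_dec u v); intros; eauto. }
destruct (ivt_strict F u v) as (x & Hx & E); auto.
exists x. split; auto. apply K. lra.
Qed.

Lemma sh_surj f d : sh f d -> forall y, 0 < y -> exists x, 0 < x /\ f x = y.
Proof.
intros H y Hy.
destruct (sh_zero _ _ H y) as (e & He & HE). specialize (HE (e / 2) ltac:(lra)).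
destruct (sh_infty _ _ H y Hy) as (N & HN).
specialize (HN (Rmax N 0 + 1)).
assert (M1 := Rmax_l N 0). assert (M2 := Rmax_r N 0).
specialize (HN ltac:(lra) ltac:(lra)).
destruct (ivt_interval (fun x => f x - y) (fun x => 0 < x) (Rmax N 0 + 1) (e / 2))
  as (x & Hx & E); try lra.
- intros; lra.
- intros x Hx. apply (continuity_pt_minus f (fun _ => y)).
  eapply sh_cont; eauto. apply continuity_pt_const. intros ? ?; auto.
- exists x. split; auto. lra.
Qed.

(** * Equations for the pole of a circle *)

Lemma cp_plus f g x : continuity_pt f x -> continuity_pt g x ->
  continuity_pt (fun x => f x + g x) x.
Proof. exact (continuity_pt_plus f g x). Qed.
Lemma cp_minus f g x : continuity_pt f x -> continuity_pt g x ->
  continuity_pt (fun x => f x - g x) x.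
Proof. exact (continuity_pt_minus f g x). Qed.
Lemma cp_mult f g x : continuity_pt f x -> continuity_pt g x ->
  continuity_pt (fun x => f x * g x) x.
Proof. exact (continuity_pt_mult f g x). Qed.
Lemma cp_const c x : continuity_pt (fun _ => c) x.
Proof. apply continuity_pt_const. intros ? ?; auto. Qed.
Lemma cp_id x : continuity_pt (fun x => x) x.
Proof. apply derivable_continuous_pt, derivable_pt_id. Qed.
Lemma cp_opp f x : continuity_pt f x -> continuity_pt (fun x => - f x) x.
Proof. exact (continuity_pt_opp f x). Qed.
Lemma cp_comp f h x : continuity_pt h x -> continuity_pt f (h x) ->
  continuity_pt (fun x => f (h x)) x.
Proof. exact (continuity_pt_comp h f x). Qed.

Ltac sh_cont_tac := first
  [ eapply sh_cont; [eassumption | lra] | eapply sh_d_cont; [eassumption | lra] ].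
Ltac cont := first
  [ apply cp_const | apply cp_id | sh_cont_tac | apply cp_minus; cont | apply cp_plus; cont
  | apply cp_mult; cont | apply cp_opp; cont | apply cp_comp; [cont | sh_cont_tac] ].

(** Uniqueness is asked only in the form that two roots contradict each other: a monotone ratio of
    the terms of [F] gives this even where [F] itself is not monotone. *)
Lemma unique_root (F : R -> R) (P : R -> Prop) u v :
  (forall x y z, P x -> P y -> x <= z <= y -> P z) ->
  (forall x, P x -> continuity_pt F x) -> P u -> P v ->
  F u < 0 -> 0 < F v ->
  (forall x y, P x -> P y -> x < y -> F x = 0 -> F y = 0 -> False) ->
  exists! x, P x /\ F x = 0.
Proof.
intros Hc HC Pu Pv Fu Fv Hm.
destruct (ivt_interval F P u v) as (x & Px & Ex); auto.
exists x. split; auto. intros y [Py Ey].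
destruct (Rtotal_order x y) as [L|[L|L]]; auto; exfalso; eauto.
Qed.

Lemma sh_zero_mult f d : sh f d -> forall M k r, 0 < k -> 0 < r ->
  exists e, 0 < e < r /\ M < k * f e.
Proof.
intros H M k r Hk Hr.
destruct (sh_zero _ _ H (M / k)) as (e & He & HE).
assert (M1 := Rmin_l e r). assert (M2 := Rmin_r e r).
assert (M3 : 0 < Rmin e r) by (apply Rmin_pos; lra).
exists (Rmin e r / 2). split. lra.
specialize (HE (Rmin e r / 2) ltac:(lra)).
apply Rmult_lt_compat_l with (r := k) in HE; auto.
replace (k * (M / k)) with M in HE by (field; lra). auto.
Qed.

(** Both quotients of shifted by unshifted differences are compared with [d (v + e) / d v], using
    [sh_shift_max] at the middle point. *)
Lemma sh_diff_ratio f d : sh f d -> forall u v w e, 0 < u -> u < v -> v < w -> 0 < e ->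
  (f (u + e) - f (v + e)) * (f v - f w) < (f u - f v) * (f (v + e) - f (w + e)).
Proof.
intros H u v w e Hu Huv Hvw He.
assert (A := sh_shift_max _ _ H v u e ltac:(lra) Hu ltac:(lra) He).
assert (B := sh_shift_max _ _ H v w e ltac:(lra) ltac:(lra) ltac:(lra) He).
assert (D := sh_dpos _ _ H v ltac:(lra)).
assert (M1 := sh_decr _ _ H u v Hu Huv).
assert (M2 := sh_decr _ _ H v w ltac:(lra) Hvw).
apply Rmult_lt_reg_r with (d v); auto.
apply Rmult_lt_compat_r with (r := f v - f w) in A; [|lra].
assert (B' : d (v + e) * (f v - f w) < (f (v + e) - f (w + e)) * d v) by lra.
apply Rmult_lt_compat_r with (r := f u - f v) in B'; [|lra]. lra.
Qed.

(** [y1] and [y2] are heights over the horizontal asymptote at two points of the right arm. The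
    ratio [f (x2 + b) / f (x1 + b)] increases from 0 to 1 with [b] and has to equal [y2 / y1]. *)
Lemma root_right f d x1 x2 y1 y2 : sh f d -> x1 < x2 -> 0 < y2 < y1 ->
  exists! b, 0 < x1 + b /\ y2 * f (x1 + b) - y1 * f (x2 + b) = 0.
Proof.
intros H Hx Hy.
destruct (sh_zero_mult _ _ H (y1 * f (x2 - x1)) y2 1 ltac:(lra) ltac:(lra)) as (e & He & HE).
destruct (sh_ratio _ _ H (x2 - x1) (y2 / y1) ltac:(lra)) as (N & HN).
{ apply Rmult_lt_reg_r with y1. lra. replace (y2 / y1 * y1) with y2 by (field; lra). lra. }
set (z := Rmax N 0 + 1). assert (M1 := Rmax_l N 0). assert (M2 := Rmax_r N 0).
specialize (HN z ltac:(unfold z; lra) ltac:(unfold z; lra)).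
apply unique_root with (F := fun b => y2 * f (x1 + b) - y1 * f (x2 + b))
  (P := fun b => 0 < x1 + b) (u := z - x1) (v := e - x1); try lra.
- intros; lra.
- intros b Hb. cont.
- unfold z; lra.
- replace (x1 + (z - x1)) with z by ring.
  replace (x2 + (z - x1)) with (z + (x2 - x1)) by ring.
  apply Rmult_lt_compat_l with (r := y1) in HN; [|lra].
  replace (y1 * (y2 / y1 * f z)) with (y2 * f z) in HN by (field; lra). lra.
- replace (x1 + (e - x1)) with e by ring.
  assert (A := sh_decr _ _ H (x2 - x1) (x2 + (e - x1)) ltac:(lra) ltac:(lra)). nra.
- intros b b' Hb Hb' L E E'.
  assert (A := sh_ratio_incr _ _ H (x1 + b) (b' - b) (x2 - x1) Hb ltac:(lra) ltac:(lra)).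
  replace (x1 + b + (b' - b)) with (x1 + b') in A by ring.
  replace (x1 + b + (x2 - x1) + (b' - b)) with (x2 + b') in A by ring.
  replace (x1 + b + (x2 - x1)) with (x2 + b) in A by ring.
  assert (P := sh_pos _ _ H (x1 + b) Hb). assert (P' := sh_pos _ _ H (x1 + b') Hb').
  apply Rmult_lt_compat_l with (r := y1) in A; [|lra].
  replace (y1 * (f (x2 + b) * f (x1 + b'))) with ((y1 * f (x2 + b)) * f (x1 + b')) in A by ring.
  replace (y1 * (f (x1 + b) * f (x2 + b'))) with ((y1 * f (x2 + b')) * f (x1 + b)) in A by ring.
  replace (y1 * f (x2 + b)) with (y2 * f (x1 + b)) in A by lra.
  replace (y1 * f (x2 + b')) with (y2 * f (x1 + b')) in A by lra. lra.
Qed.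

(** The pole lies between [x1] and [x2]; [q] is the depth below the asymptote at [x1] and [p] the
    height above it at [x2]. Here the two terms are monotone in opposite directions. *)
Lemma root_mixed f d g e x1 x2 p q : sh f d -> sh g e -> x1 < x2 -> 0 < p -> 0 < q ->
  exists! b, (0 < x2 + b /\ 0 < - x1 - b) /\ p * g (- x1 - b) - q * f (x2 + b) = 0.
Proof.
intros H G Hx Hp Hq.
(* Half the distance: when one argument is below [h], the other exceeds it, so only one term blows
   up at each end. *)
set (h := (x2 - x1) / 2).
destruct (sh_zero_mult _ _ H (p * g h) q h ltac:(lra) ltac:(unfold h; lra)) as (e1 & He1 & HE1).
destruct (sh_zero_mult _ _ G (q * f h) p h ltac:(lra) ltac:(unfold h; lra)) as (e2 & He2 & HE2).
unfold h in *.
apply unique_root with (F := fun b => p * g (- x1 - b) - q * f (x2 + b))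
  (P := fun b => 0 < x2 + b /\ 0 < - x1 - b) (u := e1 - x2) (v := - x1 - e2); try lra.
- intros; lra.
- intros b Hb. cont.
- replace (x2 + (e1 - x2)) with e1 by ring.
  assert (A := sh_decr _ _ G ((x2 - x1) / 2) (- x1 - (e1 - x2)) ltac:(lra) ltac:(lra)). nra.
- replace (- x1 - (- x1 - e2)) with e2 by ring.
  assert (A := sh_decr _ _ H ((x2 - x1) / 2) (x2 + (- x1 - e2)) ltac:(lra) ltac:(lra)). nra.
- intros b b' Hb Hb' L E E'.
  assert (A := sh_decr _ _ H (x2 + b) (x2 + b') ltac:(lra) ltac:(lra)).
  assert (B := sh_decr _ _ G (- x1 - b') (- x1 - b) ltac:(lra) ltac:(lra)). nra.
Qed.

(** [m1] and [m2] are the drops between consecutive points of the right arm. Their ratio must equal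
    a quotient of differences of [f] that decreases in [b] from infinity to [(x2 - x1) / (x3 - x2)];
    the last hypothesis places it above that limit. *)
Lemma root_convex f d x1 x2 x3 m1 m2 : sh f d -> x1 < x2 -> x2 < x3 -> 0 < m1 -> 0 < m2 ->
  m2 * (x2 - x1) < m1 * (x3 - x2) ->
  exists! b, 0 < x1 + b /\
    m2 * (f (x1 + b) - f (x2 + b)) - m1 * (f (x2 + b) - f (x3 + b)) = 0.
Proof.
intros H Hx Hx' Hm1 Hm2 Hm.
destruct (sh_zero_mult _ _ H ((m1 + m2) * f (x2 - x1)) m2 1 ltac:(lra) ltac:(lra)) as (e & He & HE).
assert (Q : 0 < m1 * (x3 - x2)) by (apply Rmult_lt_0_compat; lra).
destruct (sh_d_ratio _ _ H (x3 - x1) (m2 * (x2 - x1) / (m1 * (x3 - x2))) ltac:(lra)) as (z & Hz & HN).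
{ apply Rmult_lt_reg_r with (m1 * (x3 - x2)); auto.
  unfold Rdiv. rewrite Rmult_assoc, Rinv_l; lra. }
specialize (HN z ltac:(lra)).
apply unique_root with (P := fun b => 0 < x1 + b)
  (F := fun b => m2 * (f (x1 + b) - f (x2 + b)) - m1 * (f (x2 + b) - f (x3 + b)))
  (u := z - x1) (v := e - x1); try lra.
- intros; lra.
- intros b Hb. cont.
- replace (x1 + (z - x1)) with z by ring.
  assert (A := sh_drop_lt _ _ H z (x2 + (z - x1)) Hz ltac:(lra)).
  assert (B := sh_drop_gt _ _ H (x2 + (z - x1)) (x3 + (z - x1)) ltac:(lra) ltac:(lra)).
  replace (x3 + (z - x1)) with (z + (x3 - x1)) in * by ring.
  apply Rmult_lt_compat_l with (r := m1 * (x3 - x2)) in HN; auto.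
  replace (m1 * (x3 - x2) * (m2 * (x2 - x1) / (m1 * (x3 - x2)) * d z))
    with (m2 * (x2 - x1) * d z) in HN by (field; lra).
  apply Rmult_lt_compat_l with (r := m2) in A; auto.
  apply Rmult_lt_compat_l with (r := m1) in B; auto. nra.
- replace (x1 + (e - x1)) with e by ring.
  assert (A := sh_decr _ _ H (x2 - x1) (x2 + (e - x1)) ltac:(lra) ltac:(lra)).
  assert (P := sh_pos _ _ H (x3 + (e - x1)) ltac:(lra)). nra.
- intros b b' Hb Hb' L E E'.
  assert (A := sh_diff_ratio _ _ H (x1 + b) (x2 + b) (x3 + b) (b' - b) Hb ltac:(lra) ltac:(lra) ltac:(lra)).
  replace (x1 + b + (b' - b)) with (x1 + b') in A by ring.
  replace (x2 + b + (b' - b)) with (x2 + b') in A by ring.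
  replace (x3 + b + (b' - b)) with (x3 + b') in A by ring.
  assert (P := sh_decr _ _ H (x1 + b) (x2 + b) ltac:(lra) ltac:(lra)).
  assert (P' := sh_decr _ _ H (x1 + b') (x2 + b') ltac:(lra) ltac:(lra)).
  set (s := f (x1 + b) - f (x2 + b)) in *. set (s' := f (x1 + b') - f (x2 + b')) in *.
  set (t := f (x2 + b) - f (x3 + b)) in *. set (t' := f (x2 + b') - f (x3 + b')) in *.
  apply Rmult_lt_compat_l with (r := m1) in A; auto.
  replace (m1 * (s' * t)) with (s' * (m1 * t)) in A by ring.
  replace (m1 * (s * t')) with (s * (m1 * t')) in A by ring.
  replace (m1 * t) with (m2 * s) in A by lra.
  replace (m1 * t') with (m2 * s') in A by lra. lra.
Qed.

(** [x1] is on the left arm, [x2] and [x3] on the right; [p] and [q] are the heights of the second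
    point over the first and the third. Divided by [f (x2 + b)], the left side decreases strictly,
    because [f (x3 + b)] and [g (- x1 - b)] both grow relative to [f (x2 + b)]. *)
Lemma root_wrap f d g e x1 x2 x3 p q : sh f d -> sh g e -> x1 < x2 -> x2 < x3 -> 0 < q < p ->
  exists! b, (0 < x2 + b /\ 0 < - x1 - b) /\
    p * (f (x2 + b) - f (x3 + b)) - q * (f (x2 + b) + g (- x1 - b)) = 0.
Proof.
intros H G Hx Hx' Hq.
set (h := (x2 - x1) / 2).
destruct (sh_zero_mult _ _ H (p * f (x3 - x2) + q * g h) (p - q) h ltac:(lra) ltac:(unfold h; lra))
  as (e1 & He1 & HE1).
destruct (sh_zero_mult _ _ G (p * f h) q h ltac:(lra) ltac:(unfold h; lra)) as (e2 & He2 & HE2).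
unfold h in *.
apply unique_root with (P := fun b => 0 < x2 + b /\ 0 < - x1 - b)
  (F := fun b => p * (f (x2 + b) - f (x3 + b)) - q * (f (x2 + b) + g (- x1 - b)))
  (u := - x1 - e2) (v := e1 - x2); try lra.
- intros; lra.
- intros b Hb. cont.
- replace (- x1 - (- x1 - e2)) with e2 by ring.
  assert (A := sh_decr _ _ H ((x2 - x1) / 2) (x2 + (- x1 - e2)) ltac:(lra) ltac:(lra)).
  assert (B := sh_pos _ _ H (x2 + (- x1 - e2)) ltac:(lra)).
  assert (C := sh_pos _ _ H (x3 + (- x1 - e2)) ltac:(lra)). nra.
- replace (x2 + (e1 - x2)) with e1 by ring.
  assert (A := sh_decr _ _ G ((x2 - x1) / 2) (- x1 - (e1 - x2)) ltac:(lra) ltac:(lra)).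
  assert (B := sh_decr _ _ H (x3 - x2) (x3 + (e1 - x2)) ltac:(lra) ltac:(lra)). nra.
- intros b b' Hb Hb' L E E'.
  assert (A := sh_ratio_incr _ _ H (x2 + b) (b' - b) (x3 - x2) ltac:(lra) ltac:(lra) ltac:(lra)).
  replace (x2 + b + (b' - b)) with (x2 + b') in A by ring.
  replace (x2 + b + (x3 - x2) + (b' - b)) with (x3 + b') in A by ring.
  replace (x2 + b + (x3 - x2)) with (x3 + b) in A by ring.
  assert (B := sh_decr _ _ G (- x1 - b') (- x1 - b) ltac:(lra) ltac:(lra)).
  assert (C := sh_decr _ _ H (x2 + b) (x2 + b') ltac:(lra) ltac:(lra)).
  assert (P := sh_pos _ _ H (x2 + b) ltac:(lra)).
  assert (P' := sh_pos _ _ H (x2 + b') ltac:(lra)).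
  assert (P1 := sh_pos _ _ G (- x1 - b) ltac:(lra)).
  set (s := f (x2 + b)) in *. set (s' := f (x2 + b')) in *.
  set (t := g (- x1 - b)) in *. set (t' := g (- x1 - b')) in *.
  set (w := f (x3 + b)) in *. set (w' := f (x3 + b')) in *.
  apply Rmult_lt_compat_l with (r := p) in A; [|lra].
  replace (p * (w * s')) with ((p * w) * s') in A by ring.
  replace (p * (s * w')) with (s * (p * w')) in A by ring.
  replace (p * w) with ((p - q) * s - q * t) in A by lra.
  replace (p * w') with ((p - q) * s' - q * t') in A by lra.
  assert (t * s' < t' * s) by nra. nra.
Qed.

(** Here [k] is the steepness at the origin, which has distance [b] from the pole, and [m] is the
    drop to abscissa [x]. The ratio [(f b - f (x + b)) / d b] increases from 0 to [x]. *)
Lemma root_tangent_near f d x m k : sh f d -> 0 < x -> 0 < m < k * x -> 0 < k ->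
  exists! b, 0 < b /\ k * (f b - f (x + b)) - m * d b = 0.
Proof.
intros H Hx Hm Hk.
destruct (sh_quot_zero _ _ H (m / k) ltac:(apply Rdiv_lt_0_compat; lra)) as (e & He & HE).
assert (Q : 0 < k * x) by lra.
destruct (sh_d_ratio _ _ H x (m / (k * x)) Hx) as (z & Hz & HN).
{ apply Rmult_lt_reg_r with (k * x); auto.
  unfold Rdiv. rewrite Rmult_assoc, Rinv_l; lra. }
apply unique_root with (P := fun b => 0 < b)
  (F := fun b => k * (f b - f (x + b)) - m * d b) (u := e / 2) (v := z); try lra.
- intros; lra.
- intros b Hb. cont.
- specialize (HE (e / 2) ltac:(lra)).
  assert (P := sh_pos _ _ H (x + e / 2) ltac:(lra)).
  apply Rmult_lt_compat_l with (r := k) in HE; auto.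
  replace (k * (m / k * d (e / 2))) with (m * d (e / 2)) in HE by (field; lra). nra.
- specialize (HN z ltac:(lra)).
  assert (A := sh_drop_gt _ _ H z (x + z) Hz ltac:(lra)).
  rewrite (Rplus_comm z x) in HN.
  apply Rmult_lt_compat_l with (r := k * x) in HN; auto.
  replace (k * x * (m / (k * x) * d z)) with (m * d z) in HN by (field; lra). nra.
- intros b b' Hb Hb' L E E'.
  assert (A := sh_shift_max _ _ H b (x + b) (b' - b) Hb ltac:(lra) ltac:(lra) ltac:(lra)).
  replace (x + b + (b' - b)) with (x + b') in A by ring.
  replace (b + (b' - b)) with b' in A by ring.
  apply Rmult_lt_compat_l with (r := k) in A; auto.
  replace (k * ((f (x + b') - f b') * d b)) with (- (k * (f b' - f (x + b'))) * d b) in A by ring.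
  replace (k * (d b' * (f (x + b) - f b))) with (- (k * (f b - f (x + b))) * d b') in A by ring.
  replace (k * (f b - f (x + b))) with (m * d b) in A by lra.
  replace (k * (f b' - f (x + b'))) with (m * d b') in A by lra. lra.
Qed.

(** The steepness [k] is now prescribed at the point farther from the pole:
    [(f b - f (x + b)) / d (x + b)] decreases from infinity to [x]. *)
Lemma root_tangent_far f d x m k : sh f d -> 0 < x -> k * x < m -> 0 < k ->
  exists! b, 0 < b /\ k * (f b - f (x + b)) - m * d (x + b) = 0.
Proof.
intros H Hx Hm Hk.
assert (Q : 0 < k * x) by (apply Rmult_lt_0_compat; lra).
destruct (sh_zero_mult _ _ H (k * f x + m * d x) k 1 Hk ltac:(lra)) as (e & He & HE).
destruct (sh_d_ratio _ _ H x (k * x / m) Hx) as (z & Hz & HN).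
{ apply Rmult_lt_reg_r with m. lra.
  unfold Rdiv. rewrite Rmult_assoc, Rinv_l; lra. }
apply unique_root with (P := fun b => 0 < b)
  (F := fun b => k * (f b - f (x + b)) - m * d (x + b)) (u := z) (v := e); try lra.
- intros; lra.
- intros b Hb. cont.
- specialize (HN z ltac:(lra)).
  assert (A := sh_drop_lt _ _ H z (x + z) Hz ltac:(lra)).
  rewrite (Rplus_comm z x) in HN.
  apply Rmult_lt_compat_l with (r := m) in HN; [|lra].
  replace (m * (k * x / m * d z)) with (k * x * d z) in HN by (field; lra). nra.
- assert (A := sh_decr _ _ H x (x + e) Hx ltac:(lra)).
  assert (B := sh_d_decr _ _ H x (x + e) Hx ltac:(lra)). nra.
- intros b b' Hb Hb' L E E'.
  assert (A := sh_shift_max _ _ H (x + b) b (b' - b) ltac:(lra) ltac:(lra) ltac:(lra) ltac:(lra)).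
  replace (x + b + (b' - b)) with (x + b') in A by ring.
  replace (b + (b' - b)) with b' in A by ring.
  apply Rmult_lt_compat_l with (r := k) in A; auto.
  replace (k * ((f b' - f (x + b')) * d (x + b))) with ((k * (f b' - f (x + b'))) * d (x + b)) in A by ring.
  replace (k * (d (x + b') * (f b - f (x + b)))) with ((k * (f b - f (x + b))) * d (x + b')) in A by ring.
  replace (k * (f b - f (x + b))) with (m * d (x + b)) in A by lra.
  replace (k * (f b' - f (x + b'))) with (m * d (x + b')) in A by lra. lra.
Qed.

(** The pole separates the point of tangency, at distance [v], from the second point, at distance
    [x - v]. The ratio [(f (x - v) + g v) / e v] increases from 0 to infinity. *)
Lemma root_tangent_across f d g e x m k : sh f d -> sh g e -> 0 < x -> 0 < m -> 0 < k ->
  exists! v, (0 < v /\ 0 < x - v) /\ k * (f (x - v) + g v) - m * e v = 0.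
Proof.
intros H G Hx Hm Hk.
(* Half of [m / k], because at [e1] below the summand [f (x - e1)] is bounded by [g e1] as well. *)
assert (Q : 0 < m / (2 * k)) by (apply Rdiv_lt_0_compat; lra).
destruct (sh_quot_zero _ _ G _ Q) as (r & Hr & HR).
assert (R1 := Rmin_l r (x / 2)). assert (R2 := Rmin_r r (x / 2)).
destruct (sh_zero_mult _ _ G (f (x / 2)) 1 (Rmin r (x / 2)) ltac:(lra)) as (e1 & He1 & HE1).
{ apply Rmin_pos; lra. }
destruct (sh_zero_mult _ _ H (m * e (x / 2)) k (x / 2) Hk ltac:(lra)) as (e2 & He2 & HE2).
apply unique_root with (P := fun v => 0 < v /\ 0 < x - v)
  (F := fun v => k * (f (x - v) + g v) - m * e v) (u := e1) (v := x - e2); try lra.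
- intros; lra.
- intros b Hb. cont.
- specialize (HR e1 ltac:(lra)).
  assert (A := sh_decr _ _ H (x / 2) (x - e1) ltac:(lra) ltac:(lra)).
  apply Rmult_lt_compat_l with (r := 2 * k) in HR; [|lra].
  replace (2 * k * (m / (2 * k) * e e1)) with (m * e e1) in HR by (field; lra). nra.
- replace (x - (x - e2)) with e2 by ring.
  assert (P := sh_pos _ _ G (x - e2) ltac:(lra)).
  assert (A := sh_d_decr _ _ G (x / 2) (x - e2) ltac:(lra) ltac:(lra)). nra.
- intros b b' Hb Hb' L E E'.
  assert (A := sh_quot_incr _ _ G b (b' - b) ltac:(lra) ltac:(lra)).
  replace (b + (b' - b)) with b' in A by ring.
  assert (B := sh_decr _ _ H (x - b') (x - b) ltac:(lra) ltac:(lra)).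
  assert (P := sh_pos _ _ H (x - b) ltac:(lra)).
  assert (D := sh_d_decr _ _ G b b' ltac:(lra) ltac:(lra)).
  assert (D' := sh_dpos _ _ G b' ltac:(lra)).
  set (t := f (x - b)) in *. set (t' := f (x - b')) in *.
  assert (W : e b' * (t + g b) < e b * (t' + g b')) by nra.
  apply Rmult_lt_compat_l with (r := k) in W; auto.
  replace (k * (e b' * (t + g b))) with (e b' * (k * (t + g b))) in W by ring.
  replace (k * (e b * (t' + g b'))) with (e b * (k * (t' + g b'))) in W by ring.
  replace (k * (t + g b)) with (m * e b) in W by lra.
  replace (k * (t' + g b')) with (m * e b') in W by lra. lra.
Qed.

(** The second point is at infinity, on the asymptote: [f b / d b] increases from 0 to infinity. *)
Lemma root_tangent_infty f d m k : sh f d -> 0 < m -> 0 < k ->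
  exists! b, 0 < b /\ k * f b - m * d b = 0.
Proof.
intros H Hm Hk.
assert (Q : 0 < m / k) by (apply Rdiv_lt_0_compat; lra).
destruct (sh_quot_zero _ _ H _ Q) as (r & Hr & HR).
destruct (sh_quot_infty _ _ H (m / k)) as (b0 & Hb0 & HB).
apply unique_root with (P := fun b => 0 < b)
  (F := fun b => k * f b - m * d b) (u := r / 2) (v := b0); try lra.
- intros; lra.
- intros b Hb. cont.
- specialize (HR (r / 2) ltac:(lra)).
  apply Rmult_lt_compat_l with (r := k) in HR; auto.
  replace (k * (m / k * d (r / 2))) with (m * d (r / 2)) in HR by (field; lra). lra.
- apply Rmult_lt_compat_l with (r := k) in HB; auto.
  replace (k * (m / k * d b0)) with (m * d b0) in HB by (field; lra). lra.
- intros b b' Hb Hb' L E E'.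
  assert (A := sh_quot_incr _ _ H b (b' - b) ltac:(lra) ltac:(lra)).
  replace (b + (b' - b)) with b' in A by ring.
  apply Rmult_lt_compat_l with (r := k) in A; auto.
  replace (k * (d b' * f b)) with (d b' * (k * f b)) in A by ring.
  replace (k * (f b' * d b)) with (d b * (k * f b')) in A by ring.
  replace (k * f b) with (m * d b) in A by lra.
  replace (k * f b') with (m * d b') in A by lra. lra.
Qed.

(** * Joining *)

(** Circles are handled by their parameters, so that uniqueness is an equality; point sets return
    when the two families are united. *)
Inductive circle := Hyp (a b c : R) | Lin (s t : R).

Definition valid (k : circle) : Prop :=
  match k with Hyp a _ _ => 0 < a | Lin s _ => s < 0 end.

Definition on (f g : R -> R) (k : circle) : Pt -> Prop :=
  match k with Hyp a b c => fbar f g a b c | Lin s t => lbar s t end.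

Lemma on_right f g a b c x y : 0 < x + b ->
  (on f g (Hyp a b c) (Some x, Some y) <-> y = a * f (x + b) + c).
Proof.
intros H. simpl. unfold fabc. destruct (Rlt_dec (- b) x); [|lra].
split; [tauto|]. intros E. split; [lra|exact E].
Qed.

Lemma on_left f g a b c x y : 0 < - x - b ->
  (on f g (Hyp a b c) (Some x, Some y) <-> y = - a * g (- x - b) + c).
Proof.
intros H. simpl. unfold fabc. destruct (Rlt_dec (- b) x); [lra|].
split; [tauto|]. intros E. split; [lra|exact E].
Qed.

Lemma hyp_cases f d g e a b c x y : sh f d -> sh g e -> 0 < a ->
  on f g (Hyp a b c) (Some x, Some y) ->
  0 < x + b /\ y = a * f (x + b) + c /\ c < y \/
  0 < - x - b /\ y = - a * g (- x - b) + c /\ y < c.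
Proof.
intros H G Ha K.
assert (x <> - b) by (simpl in K; tauto).
destruct (Rlt_le_dec 0 (x + b)).
- left. apply on_right in K; auto.
  assert (P := sh_pos _ _ H (x + b) ltac:(lra)). repeat split; auto. nra.
- right. apply on_left in K; [|lra].
  assert (P := sh_pos _ _ G (- x - b) ltac:(lra)). repeat split; auto; nra.
Qed.

(** The half turn about the origin exchanges the two arms, hence [f] and [g]. It halves the case
    analyses for joining and for touching. *)
Definition rotk (k : circle) : circle :=
  match k with Hyp a b c => Hyp a (- b) (- c) | Lin s t => Lin s (- t) end.
Definition rotp (p : Pt) : Pt := (negS1 (fst p), negS1 (snd p)).

Lemma negS1_involutive z : negS1 (negS1 z) = z.
Proof. destruct z; simpl; auto. rewrite Ropp_involutive; auto. Qed.

Lemma rotp_involutive p : rotp (rotp p) = p.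
Proof. destruct p; unfold rotp; simpl. rewrite !negS1_involutive; auto. Qed.

Lemma rotk_involutive k : rotk (rotk k) = k.
Proof. destruct k; simpl; rewrite ?Ropp_involutive; auto. Qed.

Lemma rotk_valid k : valid k -> valid (rotk k).
Proof. destruct k; auto. Qed.

Lemma on_rot f g k p : on f g k p -> on g f (rotk k) (rotp p).
Proof.
destruct k as [a b c|s t], p as [[x|] [y|]]; unfold rotp; simpl fst; simpl snd; unfold negS1;
  try (simpl; intros; lra); try (simpl; tauto).
intros K. assert (x <> - b) by (simpl in K; tauto).
destruct (Rlt_le_dec 0 (x + b)).
- apply on_right in K; auto. apply on_left. lra.
  replace (- - x - - b) with (x + b) by ring. lra.
- apply on_left in K; [|lra]. apply on_right. lra.
  replace (- x + - b) with (- x - b) by ring. lra.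
Qed.

Definition joins (f g : R -> R) (p q r : Pt) : Prop :=
  exists k, valid k /\ on f g k p /\ on f g k q /\ on f g k r /\
    forall k', valid k' -> on f g k' p -> on f g k' q -> on f g k' r -> k' = k.

Lemma joins_rotate f g p q r : joins f g p q r -> joins f g q r p.
Proof. intros (k & V & P & Q & S & U). exists k. repeat split; auto. Qed.

Lemma joins_rot f g p q r : joins g f (rotp r) (rotp q) (rotp p) -> joins f g p q r.
Proof.
intros (k & V & R & Q & P & U). exists (rotk k).
apply on_rot in P, Q, R. rewrite !rotp_involutive in *.
repeat split; auto using rotk_valid.
intros k' V' P' Q' R'. apply on_rot in P', Q', R'.
rewrite <- (U (rotk k')); auto using rotk_valid. rewrite rotk_involutive; auto.
Qed.

Lemma hyp_eq a b c a' b' c' u y : b' = b -> a' = a -> y = a * u + c -> y = a' * u + c' ->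
  Hyp a' b' c' = Hyp a b c.
Proof. intros -> -> E E'. f_equal; lra. Qed.

Ltac hyp_split H G := match goal with
  | V : valid (Hyp ?a ?b ?c), K : on ?f ?g (Hyp ?a ?b ?c) (Some ?x, Some ?y) |- _ =>
    let T := fresh in assert (T := hyp_cases _ _ _ _ _ _ _ _ _ H G V K); clear K;
    destruct T as [(? & ? & ?)|(? & ? & ?)]; try lra
  end.

(** The left arm lies below the asymptote and the right arm above it, so decreasing ordinates force
    all three points onto one arm. Strict convexity of their position then excludes the lines and
    the left arm. *)
Lemma joins_convex f d g e x1 y1 x2 y2 x3 y3 : sh f d -> sh g e ->
  x1 < x2 -> x2 < x3 -> y3 < y2 -> y2 < y1 ->
  (y2 - y3) * (x2 - x1) < (y1 - y2) * (x3 - x2) ->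
  joins f g (Some x1, Some y1) (Some x2, Some y2) (Some x3, Some y3).
Proof.
intros H G Hx Hx' Hy Hy' Hc.
destruct (root_convex f d x1 x2 x3 (y1 - y2) (y2 - y3)) as (b & (Hb & E) & U); auto; try lra.
assert (D := sh_decr _ _ H (x1 + b) (x2 + b) ltac:(lra) ltac:(lra)).
set (a := (y1 - y2) / (f (x1 + b) - f (x2 + b))).
assert (Ha : 0 < a) by (apply Rdiv_lt_0_compat; lra).
assert (E1 : a * (f (x1 + b) - f (x2 + b)) = y1 - y2) by (unfold a; field; lra).
assert (E2 : a * (f (x2 + b) - f (x3 + b)) = y2 - y3).
{ apply Rmult_eq_reg_l with (y1 - y2); [|lra]. rewrite <- E1 at 2.
  transitivity (a * ((y1 - y2) * (f (x2 + b) - f (x3 + b)))). ring.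
  replace ((y1 - y2) * (f (x2 + b) - f (x3 + b))) with ((y2 - y3) * (f (x1 + b) - f (x2 + b)))
    by lra. ring. }
exists (Hyp a b (y1 - a * f (x1 + b))). split; auto.
do 3 (split; [apply on_right; lra|]).
intros [a' b' c'|s t] V K1 K2 K3.
- do 3 hyp_split H G.
  + assert (Eb : b = b').
    { apply U. split. lra. apply Rmult_eq_reg_l with a'; [|simpl in V; lra].
      replace (y1 - y2) with (a' * (f (x1 + b') - f (x2 + b'))) by lra.
      replace (y2 - y3) with (a' * (f (x2 + b') - f (x3 + b'))) by lra. ring. }
    subst b'. apply (hyp_eq _ _ _ _ _ _ (f (x1 + b)) y1); auto; try lra.
    apply Rmult_eq_reg_r with (f (x1 + b) - f (x2 + b)); lra.
  + (* the left arm is concave *)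
    exfalso. simpl in V.
    assert (A := sh_drop_lt _ _ G (- x2 - b') (- x1 - b') ltac:(lra) ltac:(lra)).
    assert (B := sh_drop_gt _ _ G (- x3 - b') (- x2 - b') ltac:(lra) ltac:(lra)).
    apply Rmult_lt_compat_l with (r := a') in A, B; auto.
    set (D2 := e (- x2 - b')) in *.
    assert (0 < D2) by (apply (sh_dpos _ _ G); lra).
    assert (y1 - y2 < a' * D2 * (x2 - x1)) by lra.
    assert (a' * D2 * (x3 - x2) < y2 - y3) by lra.
    assert ((y1 - y2) * (x3 - x2) < a' * D2 * (x2 - x1) * (x3 - x2)) by (apply Rmult_lt_compat_r; lra).
    assert (a' * D2 * (x3 - x2) * (x2 - x1) < (y2 - y3) * (x2 - x1)) by (apply Rmult_lt_compat_r; lra).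
    lra.
- exfalso. simpl in *. subst. nra.
Qed.

Lemma joins_line f d g e x1 y1 x2 y2 x3 y3 : sh f d -> sh g e ->
  x1 < x2 -> x2 < x3 -> y3 < y2 -> y2 < y1 ->
  (y2 - y3) * (x2 - x1) = (y1 - y2) * (x3 - x2) ->
  joins f g (Some x1, Some y1) (Some x2, Some y2) (Some x3, Some y3).
Proof.
intros H G Hx Hx' Hy Hy' Hc.
set (s := (y2 - y1) / (x2 - x1)).
assert (Es : s * (x2 - x1) = y2 - y1) by (unfold s; field; lra).
assert (Es' : s * (x3 - x2) = y3 - y2).
{ apply Rmult_eq_reg_r with (x2 - x1); [|lra].
  replace (s * (x3 - x2) * (x2 - x1)) with (s * (x2 - x1) * (x3 - x2)) by ring.
  rewrite Es. lra. }
exists (Lin s (y1 - s * x1)). split. simpl; nra.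
do 3 (split; [simpl; lra|]).
intros [a' b' c'|s' t'] V K1 K2 K3.
(* Again all three points are on one arm, and a strictly convex or strictly concave arm contains no
   three collinear points. *)
- exfalso. do 3 hyp_split H G.
  + simpl in V.
    assert (A := sh_drop_lt _ _ H (x2 + b') (x3 + b') ltac:(lra) ltac:(lra)).
    assert (B := sh_drop_gt _ _ H (x1 + b') (x2 + b') ltac:(lra) ltac:(lra)).
    apply Rmult_lt_compat_l with (r := a') in A, B; auto.
    set (D2 := d (x2 + b')) in *.
    assert (y2 - y3 < a' * D2 * (x3 - x2)) by lra.
    assert (a' * D2 * (x2 - x1) < y1 - y2) by lra.
    nra.
  + simpl in V.
    assert (A := sh_drop_lt _ _ G (- x2 - b') (- x1 - b') ltac:(lra) ltac:(lra)).
    assert (B := sh_drop_gt _ _ G (- x3 - b') (- x2 - b') ltac:(lra) ltac:(lra)).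
    apply Rmult_lt_compat_l with (r := a') in A, B; auto.
    set (D2 := e (- x2 - b')) in *.
    assert (y1 - y2 < a' * D2 * (x2 - x1)) by lra.
    assert (a' * D2 * (x3 - x2) < y2 - y3) by lra.
    nra.
- simpl in *. assert (s' = s) by (apply Rmult_eq_reg_r with (x2 - x1); lra).
  subst s'. f_equal. lra.
Qed.

Lemma joins_decr f d g e x1 y1 x2 y2 x3 y3 : sh f d -> sh g e ->
  x1 < x2 -> x2 < x3 -> y3 < y2 -> y2 < y1 ->
  joins f g (Some x1, Some y1) (Some x2, Some y2) (Some x3, Some y3).
Proof.
intros H G Hx Hx' Hy Hy'.
destruct (Rtotal_order ((y2 - y3) * (x2 - x1)) ((y1 - y2) * (x3 - x2))) as [L|[L|L]].
- eapply joins_convex; eauto.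
- eapply joins_line; eauto.
- apply joins_rot. eapply (joins_convex g e f d); eauto; lra.
Qed.

(** A cyclic shift of the decreasing order: the ordinate jumps up once, between [x1] and [x2], so
    the pole lies there. *)
Lemma joins_wrap f d g e x1 y1 x2 y2 x3 y3 : sh f d -> sh g e ->
  x1 < x2 -> x2 < x3 -> y1 < y3 -> y3 < y2 ->
  joins f g (Some x1, Some y1) (Some x2, Some y2) (Some x3, Some y3).
Proof.
intros H G Hx Hx' Hy Hy'.
destruct (root_wrap f d g e x1 x2 x3 (y2 - y1) (y2 - y3)) as (b & (Hb & E) & U); auto; try lra.
assert (D := sh_decr _ _ H (x2 + b) (x3 + b) ltac:(lra) ltac:(lra)).
set (a := (y2 - y3) / (f (x2 + b) - f (x3 + b))).
assert (Ha : 0 < a) by (apply Rdiv_lt_0_compat; lra).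
assert (E1 : a * (f (x2 + b) - f (x3 + b)) = y2 - y3) by (unfold a; field; lra).
assert (E2 : a * (f (x2 + b) + g (- x1 - b)) = y2 - y1).
{ apply Rmult_eq_reg_l with (y2 - y3); [|lra]. rewrite <- E1 at 2.
  transitivity (a * ((y2 - y3) * (f (x2 + b) + g (- x1 - b)))). ring.
  replace ((y2 - y3) * (f (x2 + b) + g (- x1 - b))) with ((y2 - y1) * (f (x2 + b) - f (x3 + b)))
    by lra. ring. }
exists (Hyp a b (y2 - a * f (x2 + b))). split; auto.
split. apply on_left; lra.
do 2 (split; [apply on_right; lra|]).
intros [a' b' c'|s t] V K1 K2 K3.
- do 3 hyp_split H G.
  + exfalso. simpl in V.
    assert (A := sh_decr _ _ H (x1 + b') (x2 + b') ltac:(lra) ltac:(lra)). nra.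
  + assert (Eb : b = b').
    { apply U. split. lra. apply Rmult_eq_reg_l with a'; [|simpl in V; lra].
      replace (y2 - y1) with (a' * (f (x2 + b') + g (- x1 - b'))) by lra.
      replace (y2 - y3) with (a' * (f (x2 + b') - f (x3 + b'))) by lra. ring. }
    subst b'. apply (hyp_eq _ _ _ _ _ _ (f (x2 + b)) y2); auto; try lra.
    apply Rmult_eq_reg_r with (f (x2 + b) - f (x3 + b)); lra.
  + exfalso. simpl in V.
    assert (A := sh_decr _ _ G (- x2 - b') (- x1 - b') ltac:(lra) ltac:(lra)). nra.
- exfalso. simpl in *. subst. nra.
Qed.

Lemma joins_pole_right f d g e x1 x2 y2 x3 y3 : sh f d -> sh g e ->
  x1 < x2 -> x2 < x3 -> y3 < y2 ->
  joins f g (Some x1, None) (Some x2, Some y2) (Some x3, Some y3).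
Proof.
intros H G Hx Hx' Hy.
set (b := - x1).
assert (D := sh_decr _ _ H (x2 + b) (x3 + b) ltac:(unfold b; lra) ltac:(lra)).
set (a := (y2 - y3) / (f (x2 + b) - f (x3 + b))).
assert (Ha : 0 < a) by (apply Rdiv_lt_0_compat; lra).
assert (E1 : a * (f (x2 + b) - f (x3 + b)) = y2 - y3) by (unfold a; field; lra).
exists (Hyp a b (y2 - a * f (x2 + b))). split; auto.
split. simpl. unfold b; lra.
do 2 (split; [apply on_right; unfold b in *; lra|]).
intros [a' b' c'|s t] V K1 K2 K3; [|simpl in K1; tauto].
assert (Eb : b' = b) by (simpl in K1; unfold b; lra). subst b'.
do 2 hyp_split H G; unfold b in *; try lra.
apply (hyp_eq _ _ _ _ _ _ (f (x2 + - x1)) y2); auto; try lra.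
apply Rmult_eq_reg_r with (f (x2 + - x1) - f (x3 + - x1)); lra.
Qed.

Lemma joins_pole_mid f d g e x1 y1 x2 x3 y3 : sh f d -> sh g e ->
  x1 < x2 -> x2 < x3 -> y1 < y3 ->
  joins f g (Some x1, Some y1) (Some x2, None) (Some x3, Some y3).
Proof.
intros H G Hx Hx' Hy.
set (b := - x2).
assert (P := sh_pos _ _ H (x3 + b) ltac:(unfold b; lra)).
assert (Q := sh_pos _ _ G (- x1 - b) ltac:(unfold b; lra)).
set (a := (y3 - y1) / (f (x3 + b) + g (- x1 - b))).
assert (Ha : 0 < a) by (apply Rdiv_lt_0_compat; lra).
assert (E1 : a * (f (x3 + b) + g (- x1 - b)) = y3 - y1) by (unfold a; field; lra).
exists (Hyp a b (y3 - a * f (x3 + b))). split; auto.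
split. apply on_left; unfold b in *; lra.
split. simpl. unfold b; lra.
split. apply on_right; unfold b in *; lra.
intros [a' b' c'|s t] V K1 K2 K3; [|simpl in K2; tauto].
assert (Eb : b' = b) by (simpl in K2; unfold b; lra). subst b'.
do 2 hyp_split H G; unfold b in *; try lra.
apply (hyp_eq _ _ _ _ _ _ (f (x3 + - x2)) y3); auto; try lra.
apply Rmult_eq_reg_r with (f (x3 + - x2) + g (- x1 - - x2)); lra.
Qed.

Lemma joins_asym_right f d g e x1 y1 x2 y2 c : sh f d -> sh g e ->
  x1 < x2 -> c < y2 -> y2 < y1 ->
  joins f g (Some x1, Some y1) (Some x2, Some y2) (None, Some c).
Proof.
intros H G Hx Hy Hy'.
destruct (root_right f d x1 x2 (y1 - c) (y2 - c)) as (b & (Hb & E) & U); auto; try lra.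
assert (P := sh_pos _ _ H (x1 + b) ltac:(lra)).
set (a := (y1 - c) / f (x1 + b)).
assert (Ha : 0 < a) by (apply Rdiv_lt_0_compat; lra).
assert (E1 : a * f (x1 + b) = y1 - c) by (unfold a; field; lra).
assert (E2 : a * f (x2 + b) = y2 - c).
{ apply Rmult_eq_reg_l with (y1 - c); [|lra]. rewrite <- E1 at 2.
  transitivity (a * ((y1 - c) * f (x2 + b))). ring.
  replace ((y1 - c) * f (x2 + b)) with ((y2 - c) * f (x1 + b)) by lra. ring. }
exists (Hyp a b c). split; auto.
do 2 (split; [apply on_right; lra|]). split. simpl; auto.
intros [a' b' c'|s t] V K1 K2 K3; [|simpl in K3; tauto].
assert (c' = c) by (simpl in K3; auto). subst c'.
do 2 hyp_split H G.
assert (Eb : b = b').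
{ apply U. split. lra. apply Rmult_eq_reg_l with a'; [|simpl in V; lra].
  replace (y1 - c) with (a' * f (x1 + b')) by lra.
  replace (y2 - c) with (a' * f (x2 + b')) by lra. ring. }
subst b'. f_equal. apply Rmult_eq_reg_r with (f (x1 + b)); lra.
Qed.

Lemma joins_asym_mixed f d g e x1 y1 x2 y2 c : sh f d -> sh g e ->
  x1 < x2 -> y1 < c -> c < y2 ->
  joins f g (Some x1, Some y1) (Some x2, Some y2) (None, Some c).
Proof.
intros H G Hx Hy Hy'.
destruct (root_mixed f d g e x1 x2 (y2 - c) (c - y1)) as (b & (Hb & E) & U); auto; try lra.
assert (P := sh_pos _ _ H (x2 + b) ltac:(lra)).
set (a := (y2 - c) / f (x2 + b)).
assert (Ha : 0 < a) by (apply Rdiv_lt_0_compat; lra).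
assert (E1 : a * f (x2 + b) = y2 - c) by (unfold a; field; lra).
assert (E2 : a * g (- x1 - b) = c - y1).
{ apply Rmult_eq_reg_l with (y2 - c); [|lra]. rewrite <- E1 at 2.
  transitivity (a * ((y2 - c) * g (- x1 - b))). ring.
  replace ((y2 - c) * g (- x1 - b)) with ((c - y1) * f (x2 + b)) by lra. ring. }
exists (Hyp a b c). split; auto.
split. apply on_left; lra. split. apply on_right; lra. split. simpl; auto.
intros [a' b' c'|s t] V K1 K2 K3; [|simpl in K3; tauto].
assert (c' = c) by (simpl in K3; auto). subst c'.
do 2 hyp_split H G.
assert (Eb : b = b').
{ apply U. split. lra. apply Rmult_eq_reg_l with a'; [|simpl in V; lra].
  replace (y2 - c) with (a' * f (x2 + b')) by lra.
  replace (c - y1) with (a' * g (- x1 - b')) by lra. ring. }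
subst b'. f_equal. apply Rmult_eq_reg_r with (f (x2 + b)); lra.
Qed.

Lemma joins_asym_pole f d g e x1 x2 y2 c : sh f d -> sh g e ->
  x1 < x2 -> c < y2 ->
  joins f g (Some x1, None) (Some x2, Some y2) (None, Some c).
Proof.
intros H G Hx Hy.
assert (P := sh_pos _ _ H (x2 + - x1) ltac:(lra)).
set (a := (y2 - c) / f (x2 + - x1)).
assert (Ha : 0 < a) by (apply Rdiv_lt_0_compat; lra).
assert (E1 : a * f (x2 + - x1) = y2 - c) by (unfold a; field; lra).
exists (Hyp a (- x1) c). split; auto. split. simpl; lra.
split. apply on_right; lra. split. simpl; auto.
intros [a' b' c'|s t] V K1 K2 K3; [|simpl in K3; tauto].
assert (c' = c) by (simpl in K3; auto).
assert (b' = - x1) by (simpl in K1; lra). subst b' c'.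
hyp_split H G. f_equal. apply Rmult_eq_reg_r with (f (x2 + - x1)); lra.
Qed.

Lemma joins_center f g x1 y1 x2 y2 : x1 < x2 -> y2 < y1 ->
  joins f g (Some x1, Some y1) (Some x2, Some y2) (None, None).
Proof.
intros Hx Hy. set (s := (y2 - y1) / (x2 - x1)).
assert (Es : s * (x2 - x1) = y2 - y1) by (unfold s; field; lra).
exists (Lin s (y1 - s * x1)). split. simpl; nra.
do 2 (split; [simpl; lra|]). split. exact I.
intros [a' b' c'|s' t'] V K1 K2 K3. simpl in K3; tauto.
simpl in *. assert (s' = s) by (apply Rmult_eq_reg_r with (x2 - x1); lra).
subst s'. f_equal. lra.
Qed.

(* The linear order on [S1] with [None] as top; [cyc] does not depend on where the circle is cut. *)
Definition below (z w : S1) : Prop :=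
  match z, w with
  | Some x, Some y => x < y
  | Some _, None => True
  | None, _ => False
  end.

Definition cyc (x y z : S1) : Prop :=
  below x y /\ below y z \/ below y z /\ below z x \/ below z x /\ below x y.

(** Once the abscissae are sorted, the reversed cyclic order of the ordinates leaves three linear
    orders. Each splits according to whether the largest abscissa and the largest ordinate are
    infinite. *)
Lemma joins_sorted f d g e p q r : sh f d -> sh g e ->
  below (fst p) (fst q) -> below (fst q) (fst r) -> cyc (snd r) (snd q) (snd p) ->
  joins f g p q r.
Proof.
intros H G. destruct p as [[x1|] y1], q as [[x2|] y2], r as [x3 y3]; simpl; try tauto.
intros Hx Hx' [[A B]|[[A B]|[A B]]].
- destruct y3 as [y3|], y2 as [y2|]; simpl in A, B; try tauto.
  destruct x3 as [x3|], y1 as [y1|]; simpl in *.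
  + eapply joins_decr; eauto.
  + eapply joins_pole_right; eauto.
  + eapply joins_asym_right; eauto.
  + eapply joins_asym_pole; eauto.
- destruct y2 as [y2|], y1 as [y1|]; simpl in A, B; try tauto.
  destruct x3 as [x3|], y3 as [y3|]; simpl in *.
  + apply joins_rot. eapply joins_wrap; eauto; lra.
  + apply joins_rot. eapply joins_pole_right; eauto; lra.
  (* The half turn swaps the order of [x1] and [x2] but fixes the infinite abscissa; the cyclic
     rotations bring the latter back to the last place. *)
  + apply joins_rotate, joins_rotate, joins_rot, joins_rotate.
    eapply joins_asym_right; eauto; lra.
  + apply joins_center; auto.
- destruct y1 as [y1|], y3 as [y3|]; simpl in A, B; try tauto.
  destruct x3 as [x3|], y2 as [y2|]; simpl in *.
  + eapply joins_wrap; eauto.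
  + eapply joins_pole_mid; eauto.
  + eapply joins_asym_mixed; eauto.
  + apply joins_rotate, joins_rotate, joins_rot, joins_rotate.
    eapply joins_asym_pole; eauto; lra.
Qed.

Lemma cyc_rotate x y z : cyc x y z -> cyc y z x.
Proof. unfold cyc; tauto. Qed.

Lemma joins_neg f d g e p q r : sh f d -> sh g e ->
  cyc (fst p) (fst q) (fst r) -> cyc (snd r) (snd q) (snd p) -> joins f g p q r.
Proof.
intros H G [[A B]|[[A B]|[A B]]] C.
- eapply joins_sorted; eauto.
- apply joins_rotate, joins_rotate. eapply joins_sorted; eauto.
  apply cyc_rotate, cyc_rotate; auto.
- apply joins_rotate. eapply joins_sorted; eauto. apply cyc_rotate; auto.
Qed.

(** * Topology and cyclic order of the circle *)

Definition shiftS1 (a : R) (z : S1) : S1 :=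
  match z with Some x => Some (x + a) | None => None end.

(** The minus sign makes this exchange of 0 and infinity preserve the cyclic order. *)
Definition invS1 (z : S1) : S1 :=
  match z with
  | Some x => if Req_dec_T x 0 then None else Some (- / x)
  | None => Some 0
  end.

Definition extS1 (G : R -> R) (z : S1) : S1 :=
  match z with Some x => Some (G x) | None => None end.

Definition injS1 (h : S1 -> S1) : Prop := forall z w, h z = h w -> z = w.

Lemma shiftS1_cancel a z : shiftS1 (- a) (shiftS1 a z) = z.
Proof. destruct z; simpl; auto. f_equal; ring. Qed.

Lemma shiftS1_cancel' a z : shiftS1 a (shiftS1 (- a) z) = z.
Proof. destruct z; simpl; auto. f_equal; ring. Qed.

Lemma invS1_Some x : x <> 0 -> invS1 (Some x) = Some (- / x).
Proof. intros. simpl. destruct (Req_dec_T x 0); tauto. Qed.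

Lemma invS1_0 : invS1 (Some 0) = None.
Proof. simpl. destruct (Req_dec_T 0 0); tauto. Qed.

Lemma invS1_involutive z : invS1 (invS1 z) = z.
Proof.
destruct z as [x|]; simpl.
- destruct (Req_dec_T x 0); simpl; [subst; auto|].
  assert (/ x <> 0) by (apply Rinv_neq_0_compat; auto).
  destruct (Req_dec_T (- / x) 0); [lra|]. f_equal. field. lra.
- destruct (Req_dec_T 0 0); tauto.
Qed.

Lemma S1_continuous_comp g h : S1_continuous g -> S1_continuous h ->
  S1_continuous (fun z => g (h z)).
Proof. intros Hg Hh U HU. apply (Hh (fun z => U (g z))), Hg, HU. Qed.

Lemma shiftS1_continuous a : S1_continuous (shiftS1 a).
Proof.
intros U [H1 H2]. split; simpl.
- intros x Hx. destruct (H1 _ Hx) as (e & He & HE). exists e. split; auto.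
  intros y Hy. apply HE. replace (y + a - (x + a)) with (y - x) by ring. auto.
- intros HN. destruct (H2 HN) as (M & HM). exists (M + Rabs a).
  intros y Hy. apply HM. assert (T := Rabs_triang (y + a) (- a)).
  replace (y + a + - a) with y in T by ring. rewrite Rabs_Ropp in T. lra.
Qed.

Lemma negS1_continuous : S1_continuous negS1.
Proof.
intros U [H1 H2]. split; simpl.
- intros x Hx. destruct (H1 _ Hx) as (e & He & HE). exists e. split; auto.
  intros y Hy. apply HE. replace (- y - - x) with (- (y - x)) by ring.
  rewrite Rabs_Ropp; auto.
- intros HN. destruct (H2 HN) as (M & HM). exists M.
  intros y Hy. apply HM. rewrite Rabs_Ropp; auto.
Qed.

Lemma invS1_continuous : S1_continuous invS1.
Proof.
intros U [H1 H2]. split.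
- intros x Hx. destruct (Req_dec x 0) as [->|Nx].
  + rewrite invS1_0 in Hx. destruct (H2 Hx) as (M & HM).
    assert (P := Rabs_pos M).
    assert (Q : 0 < / (Rabs M + 1)) by (apply Rinv_0_lt_compat; lra).
    exists (/ (Rabs M + 1)). split; auto. intros y Hy. rewrite Rminus_0_r in Hy.
    destruct (Req_dec y 0) as [->|Ny]. rewrite invS1_0; auto.
    rewrite invS1_Some by auto. apply HM. rewrite Rabs_Ropp, Rabs_inv.
    assert (0 < Rabs y) by (apply Rabs_pos_lt; auto).
    apply Rinv_lt_contravar in Hy; [|apply Rmult_lt_0_compat; auto].
    rewrite Rinv_inv in Hy. assert (L := Rle_abs M). lra.
  + rewrite invS1_Some in Hx by auto.
    destruct (H1 _ Hx) as (e & He & HE).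
    assert (C : continuity_pt (fun x => - / x) x).
    { apply cp_opp. apply (continuity_pt_inv (fun x => x)); auto. apply cp_id. }
    destruct (C e He) as (r & Hr & HR).
    assert (Ax : 0 < Rabs x) by (apply Rabs_pos_lt; auto).
    exists (Rmin r (Rabs x)). split. apply Rmin_pos; auto.
    intros y Hy.
    assert (Y1 := Rlt_le_trans _ _ _ Hy (Rmin_l _ _)).
    assert (Y2 := Rlt_le_trans _ _ _ Hy (Rmin_r _ _)).
    assert (Ny : y <> 0).
    { intros ->. replace (0 - x) with (- x) in Y2 by ring. rewrite Rabs_Ropp in Y2. lra. }
    rewrite invS1_Some by auto. apply HE.
    destruct (Req_dec x y) as [->|Nxy]. rewrite Rminus_diag, Rabs_R0; auto.
    apply HR. split; [split|]; [exact I|exact Nxy|exact Y1].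
- intros HN. simpl in HN. destruct (H1 _ HN) as (e & He & HE).
  assert (Q : 0 < / e) by (apply Rinv_0_lt_compat; auto).
  exists (/ e). intros y Hy.
  assert (Ny : y <> 0) by (intros ->; rewrite Rabs_R0 in Hy; lra).
  rewrite invS1_Some by auto. apply HE.
  rewrite Rminus_0_r, Rabs_Ropp, Rabs_inv.
  apply Rinv_lt_contravar in Hy; [|apply Rmult_lt_0_compat; lra].
  rewrite Rinv_inv in Hy. auto.
Qed.

(** Preimages of values slightly above and below [G x] bracket a neighbourhood of [x], and preimages
    of large values bound the finite part. The hypotheses pass to the inverse map, so its continuity
    comes from the same lemma. *)
Lemma extS1_continuous G : (forall x y, x < y -> G y < G x) ->
  (forall y, exists x, G x = y) -> S1_continuous (extS1 G).
Proof.
intros Hd Hs.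
assert (Hd' : forall x y, G y < G x -> x < y).
{ intros x y L. destruct (Rtotal_order x y) as [?|[->|K]]; auto; try lra.
  apply Hd in K. lra. }
intros U [H1 H2]. split; simpl.
- intros x Hx. destruct (H1 _ Hx) as (e & He & HE).
  destruct (Hs (G x + e / 2)) as (u & Hu). destruct (Hs (G x - e / 2)) as (v & Hv).
  assert (u < x) by (apply Hd'; lra). assert (x < v) by (apply Hd'; lra).
  exists (Rmin (x - u) (v - x)). split. apply Rmin_pos; lra.
  intros y Hy.
  assert (Y1 := Rlt_le_trans _ _ _ Hy (Rmin_l _ _)).
  assert (Y2 := Rlt_le_trans _ _ _ Hy (Rmin_r _ _)).
  apply Rabs_def2 in Y1, Y2. apply HE.
  assert (G y < G u) by (apply Hd; lra). assert (G v < G y) by (apply Hd; lra).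
  apply Rabs_def1; lra.
- intros HN. destruct (H2 HN) as (M & HM).
  destruct (Hs (Rabs M + 1)) as (u & Hu). destruct (Hs (- (Rabs M + 1))) as (v & Hv).
  exists (Rmax (Rabs u) (Rabs v)). intros y Hy. apply HM.
  assert (Y1 := Rle_lt_trans _ _ _ (Rmax_l _ _) Hy).
  assert (Y2 := Rle_lt_trans _ _ _ (Rmax_r _ _) Hy).
  assert (L := Rle_abs M). assert (L0 := Rabs_pos M).
  assert (U1 := Rle_abs v). assert (U2 := Rle_abs (- u)). rewrite Rabs_Ropp in U2.
  destruct (Rle_lt_dec 0 y).
  + rewrite (Rabs_pos_eq y) in Y1, Y2 by auto. assert (G y < G v) by (apply Hd; lra).
    rewrite Rabs_left; lra.
  + rewrite (Rabs_left y) in Y1, Y2 by auto. assert (G u < G y) by (apply Hd; lra).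
    rewrite Rabs_pos_eq; lra.
Qed.

Lemma homeo_comp g h : S1_homeomorphism g -> S1_homeomorphism h ->
  S1_homeomorphism (fun z => g (h z)).
Proof.
intros (g' & A & B & C & D) (h' & A' & B' & C' & D').
exists (fun z => h' (g' z)). split; [|split; [|split]].
- intros z. rewrite A; auto.
- intros z. rewrite B'; auto.
- apply (S1_continuous_comp g h); auto.
- apply (S1_continuous_comp h' g'); auto.
Qed.

Lemma shiftS1_homeo a : S1_homeomorphism (shiftS1 a).
Proof.
exists (shiftS1 (- a)).
split; [|split; [|split]]; auto using shiftS1_cancel, shiftS1_cancel', shiftS1_continuous.
Qed.

Lemma invS1_homeo : S1_homeomorphism invS1.
Proof.
exists invS1. split; [|split; [|split]]; auto using invS1_involutive, invS1_continuous.
Qed.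

Lemma negS1_homeo : S1_homeomorphism negS1.
Proof.
exists negS1. split; [|split; [|split]]; auto using negS1_involutive, negS1_continuous.
Qed.

Lemma extS1_homeo G : (forall x y, x < y -> G y < G x) ->
  (forall y, exists x, G x = y) -> S1_homeomorphism (extS1 G).
Proof.
intros Hd Hs.
destruct (functional_choice _ Hs) as (K & HK).
assert (KG : forall x, K (G x) = x).
{ intros x. destruct (Rtotal_order (K (G x)) x) as [L|[L|L]]; auto;
  apply Hd in L; rewrite HK in L; lra. }
exists (extS1 K). split; [|split; [|split]].
- intros [x|]; simpl; auto. rewrite KG; auto.
- intros [x|]; simpl; auto. rewrite HK; auto.
- apply extS1_continuous; auto.
- apply extS1_continuous.
  + intros x y L. destruct (Rtotal_order (K y) (K x)) as [?|[E|E]]; auto; exfalso.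
    * apply (f_equal G) in E. rewrite !HK in E. lra.
    * apply Hd in E. rewrite !HK in E. lra.
  + intros y. exists (G y). auto.
Qed.

Lemma homeo_ext g h : (forall z, g z = h z) -> S1_homeomorphism g -> S1_homeomorphism h.
Proof.
intros E (g' & A & B & C & D). exists g'. split; [|split; [|split]]; auto.
- intros z. rewrite <- E; auto.
- intros z. rewrite <- E; auto.
- intros U HU. destruct (C U HU) as [P Q]. split.
  + intros x. rewrite <- E. intros Hx. destruct (P x Hx) as (e & He & HE).
    exists e. split; auto. intros y Hy. rewrite <- E; auto.
  + rewrite <- E. intros HN. destruct (Q HN) as (M & HM). exists M.
    intros y Hy. rewrite <- E; auto.
Qed.

Lemma homeo_continuous g : S1_homeomorphism g -> S1_continuous g.
Proof. intros (h & _ & _ & C & _). auto. Qed.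

Lemma homeo_inj g : S1_homeomorphism g -> injS1 g.
Proof. intros (h & A & _) z w E. rewrite <- (A z), <- (A w), E. auto. Qed.

(** The default 0 is never taken: [h] is injective and fixes infinity, so it maps finite points to
    finite points. *)
Lemma real_part_continuous h x : S1_homeomorphism h -> h None = None ->
  continuity_pt (fun u => match h (Some u) with Some y => y | None => 0 end) x.
Proof.
intros Hh HN.
assert (Hf : forall u, exists y, h (Some u) = Some y).
{ intros u. destruct (h (Some u)) eqn:E; eauto.
  rewrite <- HN in E. apply (homeo_inj _ Hh) in E. discriminate. }
apply continuity_pt_eps. intros e He.
destruct (Hf x) as (y0 & E0). rewrite E0.
set (U := fun z : S1 => match z with Some y => Rabs (y - y0) < e | None => False end).
assert (HU : S1_open U).
{ split; simpl; [|tauto]. intros y Hy. exists (e - Rabs (y - y0)). split. lra.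
  intros y' Hy'. assert (T := Rabs_triang (y' - y) (y - y0)).
  replace (y' - y + (y - y0)) with (y' - y0) in T by ring. lra. }
destruct (homeo_continuous _ Hh U HU) as [P _].
destruct (P x) as (r & Hr & HR).
{ rewrite E0. simpl. rewrite Rminus_diag, Rabs_R0; auto. }
exists r. split; auto. intros u Hu. specialize (HR u Hu).
destruct (h (Some u)); simpl in HR; tauto.
Qed.

Lemma homeo_cross h1 h2 u v a1 a2 b1 b2 :
  S1_homeomorphism h1 -> S1_homeomorphism h2 -> h1 None = None -> h2 None = None ->
  h1 (Some u) = Some a1 -> h2 (Some u) = Some a2 -> a1 < a2 ->
  h1 (Some v) = Some b1 -> h2 (Some v) = Some b2 -> b2 < b1 ->
  exists x, h1 (Some x) = h2 (Some x).
Proof.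
intros H1 H2 N1 N2 U1 U2 LU V1 V2 LV.
set (r := fun (h : S1 -> S1) x => match h (Some x) with Some y => y | None => 0 end).
destruct (ivt_interval (fun x => r h1 x - r h2 x) (fun _ => True) u v) as (x & _ & E); auto.
- intros x _. apply cp_minus; apply real_part_continuous; auto.
- unfold r. rewrite U1, U2. lra.
- unfold r. rewrite V1, V2. lra.
- exists x. unfold r in E.
  destruct (h1 (Some x)) eqn:E1.
  + destruct (h2 (Some x)) eqn:E2. f_equal; lra.
    rewrite <- N2 in E2. apply (homeo_inj _ H2) in E2. discriminate.
  + rewrite <- N1 in E1. apply (homeo_inj _ H1) in E1. discriminate.
Qed.

(* [mu] and [nu] are charts carrying the common point of [h1] and [h2] to infinity. *)
Lemma homeo_cross_charts mu nu z0 h1 h2 u v a1 a2 b1 b2 :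
  S1_homeomorphism mu -> S1_homeomorphism nu ->
  S1_homeomorphism h1 -> S1_homeomorphism h2 ->
  mu None = z0 -> nu (h1 z0) = None -> nu (h2 z0) = None ->
  nu (h1 (mu (Some u))) = Some a1 -> nu (h2 (mu (Some u))) = Some a2 -> a1 < a2 ->
  nu (h1 (mu (Some v))) = Some b1 -> nu (h2 (mu (Some v))) = Some b2 -> b2 < b1 ->
  exists z, z <> z0 /\ h1 z = h2 z.
Proof.
intros M N H1 H2 M0 N1 N2 U1 U2 LU V1 V2 LV.
destruct (homeo_cross (fun z => nu (h1 (mu z))) (fun z => nu (h2 (mu z))) u v a1 a2 b1 b2)
  as (x & E); auto; try (rewrite M0; auto).
1, 2: apply (homeo_comp nu); auto; apply homeo_comp; auto.
exists (mu (Some x)). split.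
- rewrite <- M0. intros K. apply (homeo_inj _ M) in K. discriminate.
- apply (homeo_inj _ N); auto.
Qed.

Definition cyc_pres (h : S1 -> S1) : Prop := forall x y z, cyc x y z -> cyc (h x) (h y) (h z).
Definition cyc_rev (h : S1 -> S1) : Prop := forall x y z, cyc x y z -> cyc (h z) (h y) (h x).

Lemma shiftS1_cyc a : cyc_pres (shiftS1 a).
Proof.
intros [x|] [y|] [z|]; unfold cyc; simpl; intros [[? ?]|[[? ?]|[? ?]]]; try tauto;
  first [left; split; lra | right; left; split; lra | right; right; split; lra
        | left; split; auto; lra | right; left; split; auto; lra | right; right; split; auto; lra].
Qed.

Lemma extS1_cyc G : (forall x y, x < y -> G y < G x) -> cyc_rev (extS1 G).
Proof.
intros Hd [x|] [y|] [z|]; unfold cyc; simpl; intros [[? ?]|[[? ?]|[? ?]]]; try tauto; auto 6.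
Qed.

Lemma negS1_cyc : cyc_rev negS1.
Proof.
intros [x|] [y|] [z|]; unfold cyc; simpl; intros [[? ?]|[[? ?]|[? ?]]]; try tauto;
  first [left; split; lra | right; left; split; lra | right; right; split; lra
        | left; split; auto; lra | right; left; split; auto; lra | right; right; split; auto; lra].
Qed.

Lemma neg_inv_incr x y : x < y -> 0 < x \/ y < 0 -> - / x < - / y.
Proof.
intros L [P|P]; apply Ropp_lt_contravar.
- apply Rinv_lt_contravar; nra.
- apply Rinv_lt_contravar; nra.
Qed.

Lemma invS1_cyc_sorted x y z : below x y -> below y z -> cyc (invS1 x) (invS1 y) (invS1 z).
Proof.
(* Recording the sign of the reciprocal makes every case of the order comparison linear. *)
assert (S : forall x, {x < 0 /\ 0 < - / x} + {x = 0} + {0 < x /\ - / x < 0}).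
{ intros t. destruct (total_order_T t 0) as [[L|L]|L]; auto.
  - left; left. assert (A := Rinv_lt_0_compat t L). lra.
  - right. assert (A := Rinv_0_lt_compat t L). lra. }
destruct x as [x|], y as [y|]; simpl; try tauto. intros Hxy.
assert (Ixy := neg_inv_incr x y Hxy).
destruct z as [z|]; simpl; intros Hyz; [assert (Iyz := neg_inv_incr y z Hyz)|];
  destruct (S x) as [[?|?]|?], (S y) as [[?|?]|?];
  try destruct (S z) as [[?|?]|?]; try lra;
  repeat match goal with |- context [Req_dec_T ?t 0] => destruct (Req_dec_T t 0) end; try lra;
  unfold cyc; simpl;
  first [ left; split; lra | right; left; split; lra | right; right; split; lra
        | left; split; auto; lra | right; left; split; auto; lra | right; right; split; auto; lra ].
Qed.

Lemma invS1_cyc : cyc_pres invS1.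
Proof.
intros x y z [[A B]|[[A B]|[A B]]].
- apply invS1_cyc_sorted; auto.
- apply cyc_rotate, cyc_rotate. apply invS1_cyc_sorted; auto.
- apply cyc_rotate. apply invS1_cyc_sorted; auto.
Qed.

(** * Circles as order-reversing homeomorphisms *)

Definition circ_fun (f g : R -> R) (k : circle) (z : S1) : S1 :=
  match k, z with
  | Hyp a b c, Some x => if Req_dec_T x (- b) then None else Some (fabc f g a b c x)
  | Hyp a b c, None => Some c
  | Lin s t, Some x => Some (s * x + t)
  | Lin s t, None => None
  end.

Lemma on_circ_fun f g k p : on f g k p <-> snd p = circ_fun f g k (fst p).
Proof.
destruct k as [a b c|s t], p as [[x|] [y|]]; simpl;
  try destruct (Req_dec_T x (- b)); split; intros K; try match type of K with _ /\ _ => destruct K end; try split; congruence || tauto.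
Qed.

(* [Hyp a b c] is the conjugate of this decreasing bijection by [shiftS1] and [invS1]. *)
Definition inv_arms (f g : R -> R) (a u : R) : R :=
  if Rlt_dec 0 u then - / (a * f u) else if Rlt_dec u 0 then / (a * g (- u)) else 0.

Lemma inv_arms_pos f g a u : 0 < u -> inv_arms f g a u = - / (a * f u).
Proof. intros. unfold inv_arms. destruct (Rlt_dec 0 u); lra. Qed.

Lemma inv_arms_neg f g a u : u < 0 -> inv_arms f g a u = / (a * g (- u)).
Proof.
intros. unfold inv_arms. destruct (Rlt_dec 0 u); [lra|]. destruct (Rlt_dec u 0); lra.
Qed.

Lemma inv_arms_0 f g a : inv_arms f g a 0 = 0.
Proof. unfold inv_arms. destruct (Rlt_dec 0 0); lra. Qed.

Lemma inv_arms_decr f d g e a : sh f d -> sh g e -> 0 < a ->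
  forall x y, x < y -> inv_arms f g a y < inv_arms f g a x.
Proof.
intros H G Ha.
assert (P : forall u, 0 < u -> 0 < / (a * f u)).
{ intros u Hu. apply Rinv_0_lt_compat, Rmult_lt_0_compat; auto. apply (sh_pos _ _ H); auto. }
assert (Q : forall u, u < 0 -> 0 < / (a * g (- u))).
{ intros u Hu. apply Rinv_0_lt_compat, Rmult_lt_0_compat; auto. apply (sh_pos _ _ G); lra. }
intros x y L.
destruct (Rtotal_order x 0) as [X|[X|X]], (Rtotal_order y 0) as [Y|[Y|Y]]; subst; try lra;
  rewrite ?inv_arms_0, ?(inv_arms_neg _ _ _ x), ?(inv_arms_neg _ _ _ y),
    ?(inv_arms_pos _ _ _ x), ?(inv_arms_pos _ _ _ y) by auto; auto.
- assert (A := sh_decr _ _ G (- y) (- x) ltac:(lra) ltac:(lra)).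
  assert (B := sh_pos _ _ G (- y) ltac:(lra)). assert (C := sh_pos _ _ G (- x) ltac:(lra)).
  apply Rinv_lt_contravar. repeat apply Rmult_lt_0_compat; auto. apply Rmult_lt_compat_l; auto.
- specialize (P y Y). specialize (Q x X). lra.
- specialize (P y Y). lra.
- assert (A := sh_decr _ _ H x y X L).
  assert (B := sh_pos _ _ H x X). assert (C := sh_pos _ _ H y Y).
  apply Ropp_lt_contravar, Rinv_lt_contravar. repeat apply Rmult_lt_0_compat; auto.
  apply Rmult_lt_compat_l; auto.
Qed.

Lemma inv_arms_surj f d g e a : sh f d -> sh g e -> 0 < a ->
  forall y, exists x, inv_arms f g a x = y.
Proof.
intros H G Ha y. destruct (Rtotal_order y 0) as [Y|[Y|Y]].
- assert (P : 0 < / (a * - y)) by (apply Rinv_0_lt_compat, Rmult_lt_0_compat; lra).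
  destruct (sh_surj _ _ H _ P) as (x & Hx & E). exists x.
  rewrite inv_arms_pos, E by auto. field. lra.
- exists 0. rewrite inv_arms_0; auto.
- assert (P : 0 < / (a * y)) by (apply Rinv_0_lt_compat, Rmult_lt_0_compat; lra).
  destruct (sh_surj _ _ G _ P) as (x & Hx & E). exists (- x).
  rewrite inv_arms_neg, Ropp_involutive, E by lra. field. lra.
Qed.

Lemma circ_fun_hyp f d g e a b c z : sh f d -> sh g e -> 0 < a ->
  shiftS1 c (invS1 (extS1 (inv_arms f g a) (shiftS1 b z))) = circ_fun f g (Hyp a b c) z.
Proof.
intros H G Ha. destruct z as [x|]; cbn -[invS1].
- destruct (Req_dec_T x (- b)) as [->|N].
  + rewrite Rplus_opp_l, inv_arms_0, invS1_0. auto.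
  + unfold fabc. destruct (Rlt_dec (- b) x).
    * assert (P := sh_pos _ _ H (x + b) ltac:(lra)).
      rewrite inv_arms_pos by lra.
      assert (0 < / (a * f (x + b))) by (apply Rinv_0_lt_compat, Rmult_lt_0_compat; auto).
      rewrite invS1_Some by lra. simpl. f_equal. field. lra.
    * assert (P := sh_pos _ _ G (- x - b) ltac:(lra)).
      rewrite inv_arms_neg by lra. replace (- (x + b)) with (- x - b) by ring.
      assert (0 < / (a * g (- x - b))) by (apply Rinv_0_lt_compat, Rmult_lt_0_compat; auto).
      rewrite invS1_Some by lra. simpl. f_equal. field. lra.
- simpl. f_equal; ring.
Qed.

Lemma lin_decr s t : s < 0 -> forall x y, x < y -> s * y + t < s * x + t.
Proof. intros; nra. Qed.

Lemma circ_fun_homeo f d g e k : sh f d -> sh g e -> valid k -> S1_homeomorphism (circ_fun f g k).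
Proof.
intros H G V. destruct k as [a b c|s t]; simpl in V.
- apply (homeo_ext (fun z => shiftS1 c (invS1 (extS1 (inv_arms f g a) (shiftS1 b z))))).
  + intros; eapply circ_fun_hyp; eauto.
  + apply (homeo_comp (shiftS1 c)). apply shiftS1_homeo.
    apply (homeo_comp invS1). apply invS1_homeo.
    apply (homeo_comp (extS1 _)). 2: apply shiftS1_homeo.
    apply extS1_homeo. eapply inv_arms_decr; eauto. eapply inv_arms_surj; eauto.
- apply (homeo_ext (extS1 (fun x => s * x + t))). intros [x|]; auto.
  apply extS1_homeo. apply lin_decr; auto. intros y. exists ((y - t) / s). field; lra.
Qed.

Lemma circ_fun_cyc f d g e k : sh f d -> sh g e -> valid k -> cyc_rev (circ_fun f g k).
Proof.
intros H G V x y z C. destruct k as [a b c|s t]; simpl in V.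
- rewrite <- !(circ_fun_hyp f d g e) by auto.
  apply shiftS1_cyc, invS1_cyc, extS1_cyc, shiftS1_cyc; auto.
  eapply inv_arms_decr; eauto.
- exact (extS1_cyc _ (lin_decr s t V) x y z C).
Qed.

(** * Touching *)

Definition slope (d e : R -> R) (k : circle) (x : R) : R :=
  match k with
  | Hyp a b c => if Rlt_dec (- b) x then - (a * d (x + b)) else - (a * e (- x - b))
  | Lin s t => s
  end.

Definition tangent (f g d e : R -> R) (m : R) (k : circle) : Prop :=
  valid k /\ on f g k (Some 0, Some 0) /\ slope d e k 0 = - m.

Lemma tangent_hyp f g d e m a b c : sh f d -> sh g e ->
  tangent f g d e m (Hyp a b c) <->
  0 < a /\ (0 < b /\ a * d b = m /\ c = - (a * f b) \/
            0 < - b /\ a * e (- b) = m /\ c = a * g (- b)).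
Proof.
intros H G. unfold tangent. simpl valid. unfold slope. split.
- intros (V & K & S). split; auto.
  destruct (hyp_cases _ _ _ _ _ _ _ _ _ H G V K) as [(A & B & C)|(A & B & C)];
    destruct (Rlt_dec (- b) 0); try lra.
  + rewrite Rplus_0_l in *. left. repeat split; lra.
  + replace (- 0 - b) with (- b) in * by ring. right. repeat split; lra.
- intros (V & [(A & B & C)|(A & B & C)]); (split; [auto|]); destruct (Rlt_dec (- b) 0); try lra.
  + split. apply on_right. lra. all: rewrite Rplus_0_l; lra.
  + split. apply on_left. lra. all: replace (- 0 - b) with (- b) by ring; lra.
Qed.

Lemma tangent_lin f g d e m s t : 0 < m -> tangent f g d e m (Lin s t) <-> s = - m /\ t = 0.
Proof. intros Hm. unfold tangent. simpl. split; [intros (? & ? & ?)|intros [? ?]]; repeat split; lra. Qed.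

Lemma tangent_rot f g d e m k : sh f d -> sh g e -> 0 < m ->
  tangent f g d e m k -> tangent g f e d m (rotk k).
Proof.
intros H G Hm. destruct k as [a b c|s t]; unfold rotk.
- rewrite !tangent_hyp, Ropp_involutive by auto.
  intros (A & [(B & C & D)|(B & C & D)]); split; auto; [right|left]; repeat split; lra.
- rewrite !tangent_lin by auto. lra.
Qed.

Definition touch_exists (f g d e : R -> R) (m : R) (q : Pt) : Prop :=
  exists k, tangent f g d e m k /\ on f g k q /\
    forall k', tangent f g d e m k' -> on f g k' q -> k' = k.

Lemma touch_rot f g d e m q : sh f d -> sh g e -> 0 < m ->
  touch_exists g f e d m (rotp q) -> touch_exists f g d e m q.
Proof.
intros H G Hm (k & T & K & U). exists (rotk k).
apply on_rot in K. rewrite rotp_involutive in K.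
split; [|split]; auto.
- apply tangent_rot; auto.
- intros k' T' K'. apply on_rot in K'. apply tangent_rot in T'; auto.
  rewrite <- (U (rotk k')), rotk_involutive; auto.
Qed.

Lemma tangent_pole_inj f g d e m a b c a' c' : sh f d -> sh g e ->
  tangent f g d e m (Hyp a b c) -> tangent f g d e m (Hyp a' b c') -> Hyp a' b c' = Hyp a b c.
Proof.
intros H G. rewrite !tangent_hyp by auto.
intros (A & [(B & C & D)|(B & C & D)]) (A' & [(B' & C' & D')|(B' & C' & D')]); try lra.
- assert (P := sh_dpos _ _ H b B).
  assert (a' = a) by (apply Rmult_eq_reg_r with (d b); lra). subst. auto.
- assert (P := sh_dpos _ _ G (- b) B).
  assert (a' = a) by (apply Rmult_eq_reg_r with (e (- b)); lra). subst. auto.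
Qed.

Lemma tangent_right f g d e m b : sh f d -> sh g e -> 0 < m -> 0 < b ->
  tangent f g d e m (Hyp (m / d b) b (- (m / d b * f b))).
Proof.
intros H G Hm Hb. assert (P := sh_dpos _ _ H b Hb). apply tangent_hyp; auto.
split. apply Rdiv_lt_0_compat; auto. left. repeat split; auto. field; lra.
Qed.

Lemma tangent_left f g d e m v : sh f d -> sh g e -> 0 < m -> 0 < v ->
  tangent f g d e m (Hyp (m / e v) (- v) (m / e v * g v)).
Proof.
intros H G Hm Hb. assert (P := sh_dpos _ _ G v Hb). apply tangent_hyp; auto.
rewrite Ropp_involutive.
split. apply Rdiv_lt_0_compat; auto. right. repeat split; auto. field; lra.
Qed.

(** The pole [- b] lies left of 0, between 0 and [x], or right of [x]. Correspondingly the ordinate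
    at [x] lies between the tangent line and 0, above 0, or below the tangent line, so [y] alone
    decides which equation has to be solved. *)
Lemma tangent_hyp_cases f g d e m a b c x y : sh f d -> sh g e -> 0 < m -> 0 < x ->
  tangent f g d e m (Hyp a b c) -> on f g (Hyp a b c) (Some x, Some y) ->
  0 < b /\ - (m * x) < y < 0 /\ m * (f b - f (x + b)) - - y * d b = 0 \/
  (0 < - b /\ 0 < x - - b) /\ 0 < y /\ m * (f (x - - b) + g (- b)) - y * e (- b) = 0 \/
  0 < - x - b /\ y < - (m * x) /\
    m * (g (- x - b) - g (x + (- x - b))) - - y * e (x + (- x - b)) = 0.
Proof.
intros H G Hm Hx T K. apply tangent_hyp in T; auto. destruct T as (Ha & T).
replace (x - - b) with (x + b) by ring. replace (x + (- x - b)) with (- b) by ring.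
destruct (hyp_cases _ _ _ _ _ _ _ _ _ H G Ha K) as [(A & B & C)|(A & B & C)].
- destruct T as [(P & Q & S)|(P & Q & S)].
  + left. split; [auto|].
    assert (L := sh_drop_lt _ _ H b (x + b) P ltac:(lra)).
    assert (D := sh_decr _ _ H b (x + b) P ltac:(lra)).
    apply Rmult_lt_compat_l with (r := a) in L, D; auto. subst m.
    repeat split; try lra. subst; ring.
  + right; left. repeat split; auto.
    * assert (D := sh_pos _ _ G (- b) P). nra.
    * subst; ring.
- right; right. destruct T as [(P & Q & S)|(P & Q & S)]; try lra.
  assert (L := sh_drop_gt _ _ G (- x - b) (- b) ltac:(lra) ltac:(lra)).
  apply Rmult_lt_compat_l with (r := a) in L; auto. subst m.
  repeat split; try lra. subst; ring.
Qed.

Lemma touch_near f g d e m x y : sh f d -> sh g e -> 0 < m -> 0 < x -> - (m * x) < y < 0 ->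
  touch_exists f g d e m (Some x, Some y).
Proof.
intros H G Hm Hx Hy.
destruct (root_tangent_near f d x (- y) m) as (b & (Hb & E) & U); auto; try lra.
assert (P := sh_dpos _ _ H b Hb).
assert (T := tangent_right f g d e m b H G Hm Hb).
exists (Hyp (m / d b) b (- (m / d b * f b))). split; [|split]; auto.
- apply on_right. lra. replace y with (- (m * (f b - f (x + b)) / d b)). field; lra.
  replace (m * (f b - f (x + b))) with (- y * d b) by lra. field; lra.
- intros [a' b' c'|s t] T' K.
  + destruct (tangent_hyp_cases _ _ _ _ _ _ _ _ _ _ H G Hm Hx T' K)
      as [(A & B & C)|[(A & B & C)|(A & B & C)]]; try lra.
    assert (b = b') by (apply U; auto). subst b'. apply (tangent_pole_inj f g d e m); auto.
  + apply tangent_lin in T'; auto. simpl in K. nra.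
Qed.

Lemma touch_line f g d e m x : sh f d -> sh g e -> 0 < m -> 0 < x ->
  touch_exists f g d e m (Some x, Some (- (m * x))).
Proof.
intros H G Hm Hx. exists (Lin (- m) 0). split; [|split].
- apply tangent_lin; auto.
- simpl. ring.
- intros [a' b' c'|s t] T' K.
  + destruct (tangent_hyp_cases _ _ _ _ _ _ _ _ _ _ H G Hm Hx T' K)
      as [(A & B & C)|[(A & B & C)|(A & B & C)]]; nra.
  + apply tangent_lin in T'; auto. destruct T'; subst; auto.
Qed.

Lemma touch_across f g d e m x y : sh f d -> sh g e -> 0 < m -> 0 < x -> 0 < y ->
  touch_exists f g d e m (Some x, Some y).
Proof.
intros H G Hm Hx Hy.
destruct (root_tangent_across f d g e x y m) as (v & (Hv & E) & U); auto.
assert (P := sh_dpos _ _ G v ltac:(lra)).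
assert (T := tangent_left f g d e m v H G Hm ltac:(lra)).
exists (Hyp (m / e v) (- v) (m / e v * g v)). split; [|split]; auto.
- apply on_right. lra. replace (x + - v) with (x - v) by ring.
  replace y with (m * (f (x - v) + g v) / e v). field; lra.
  replace (m * (f (x - v) + g v)) with (y * e v) by lra. field; lra.
- intros [a' b' c'|s t] T' K.
  + destruct (tangent_hyp_cases _ _ _ _ _ _ _ _ _ _ H G Hm Hx T' K)
      as [(A & B & C)|[(A & B & C)|(A & B & C)]]; try nra.
    assert (v = - b') by (apply U; auto). subst v. rewrite Ropp_involutive in *.
    apply (tangent_pole_inj f g d e m); auto.
  + apply tangent_lin in T'; auto. simpl in K. nra.
Qed.

Lemma touch_far f g d e m x y : sh f d -> sh g e -> 0 < m -> 0 < x -> y < - (m * x) ->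
  touch_exists f g d e m (Some x, Some y).
Proof.
intros H G Hm Hx Hy.
destruct (root_tangent_far g e x (- y) m) as (u & (Hu & E) & U); auto; try lra.
assert (P := sh_dpos _ _ G (x + u) ltac:(lra)).
assert (T := tangent_left f g d e m (x + u) H G Hm ltac:(lra)).
exists (Hyp (m / e (x + u)) (- (x + u)) (m / e (x + u) * g (x + u))). split; [|split]; auto.
- apply on_left. lra. replace (- x - - (x + u)) with u by ring.
  replace y with (- (m * (g u - g (x + u)) / e (x + u))). field; lra.
  replace (m * (g u - g (x + u))) with (- y * e (x + u)) by lra. field; lra.
- intros [a' b' c'|s t] T' K.
  + destruct (tangent_hyp_cases _ _ _ _ _ _ _ _ _ _ H G Hm Hx T' K)
      as [(A & B & C)|[(A & B & C)|(A & B & C)]]; try nra.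
    assert (u = - x - b') by (apply U; auto). assert (b' = - (x + u)) by lra. subst b'.
    apply (tangent_pole_inj f g d e m); auto.
  + apply tangent_lin in T'; auto. simpl in K. nra.
Qed.

Lemma touch_asym f g d e m c : sh f d -> sh g e -> 0 < m -> c < 0 ->
  touch_exists f g d e m (None, Some c).
Proof.
intros H G Hm Hc.
destruct (root_tangent_infty f d (- c) m) as (b & (Hb & E) & U); auto; try lra.
assert (P := sh_dpos _ _ H b Hb).
assert (T := tangent_right f g d e m b H G Hm Hb).
exists (Hyp (m / d b) b (- (m / d b * f b))). split; [|split]; auto.
- simpl. replace c with (- (m * f b / d b)). field; lra.
  replace (m * f b) with (- c * d b) by lra. field; lra.
- intros [a' b' c'|s t] T' K; [|simpl in K; tauto]. assert (T2 := T').
  apply tangent_hyp in T'; auto. destruct T' as (A' & [(B' & C' & D')|(B' & C' & D')]).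
  + assert (b = b') by (apply U; simpl in K; subst; split; auto; ring). subst b'.
    apply (tangent_pole_inj f g d e m); auto.
  + assert (Q := sh_pos _ _ G (- b') B'). simpl in K. nra.
Qed.

Lemma touch_pole f g d e m x : sh f d -> sh g e -> 0 < m -> 0 < x ->
  touch_exists f g d e m (Some x, None).
Proof.
intros H G Hm Hx. assert (T := tangent_left f g d e m x H G Hm Hx).
exists (Hyp (m / e x) (- x) (m / e x * g x)). split; [|split]; auto.
- simpl. lra.
- intros [a' b' c'|s t] T' K; [|simpl in K; tauto].
  assert (b' = - x) by (simpl in K; lra). subst. apply (tangent_pole_inj f g d e m); auto.
Qed.

Lemma touch_center f g d e m : sh f d -> sh g e -> 0 < m -> touch_exists f g d e m (None, None).
Proof.
intros H G Hm. exists (Lin (- m) 0). split; [|split].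
- apply tangent_lin; auto.
- exact I.
- intros [a' b' c'|s t] T' K. simpl in K; tauto.
  apply tangent_lin in T'; auto. destruct T'; subst; auto.
Qed.

Lemma touch_origin f g d e m q : sh f d -> sh g e -> 0 < m ->
  fst q <> Some 0 -> snd q <> Some 0 -> touch_exists f g d e m q.
Proof.
intros H G Hm. destruct q as [x y]; simpl. intros Nx Ny.
assert (pos : forall f g d e x y, sh f d -> sh g e -> 0 < x -> y <> Some 0 ->
  touch_exists f g d e m (Some x, y)).
{ clear - Hm. intros f g d e x [y|] H G Hx Ny.
  - destruct (Rtotal_order y 0) as [L|[L|L]].
    + destruct (Rtotal_order y (- (m * x))) as [L'|[L'|L']].
      * apply touch_far; auto.
      * subst. apply touch_line; auto.
      * apply touch_near; auto; lra.
    + subst; tauto.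
    + apply touch_across; auto.
  - apply touch_pole; auto. }
destruct x as [x|].
- destruct (Rtotal_order x 0) as [L|[L|L]]; [|subst; tauto|auto].
  apply touch_rot; auto. apply pos; auto. lra.
  destruct y as [y|]; simpl; [|discriminate].
  intros K. injection K as K. apply Ny. f_equal. lra.
- destruct y as [c|]; [|apply touch_center; auto].
  assert (c <> 0) by (intros ->; auto).
  destruct (Rlt_le_dec c 0). apply touch_asym; auto.
  apply touch_rot; auto. apply touch_asym; auto. lra.
Qed.

(** * Translation from the origin to an arbitrary finite point *)

Definition shiftk (x0 y0 : R) (k : circle) : circle :=
  match k with Hyp a b c => Hyp a (b + x0) (c - y0) | Lin s t => Lin s (t + s * x0 - y0) end.

Definition shiftp (x0 y0 : R) (p : Pt) : Pt := (shiftS1 (- x0) (fst p), shiftS1 (- y0) (snd p)).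

Lemma shiftk_cancel x0 y0 k : shiftk (- x0) (- y0) (shiftk x0 y0 k) = k.
Proof. destruct k; simpl; f_equal; ring. Qed.

Lemma shiftp_cancel x0 y0 p : shiftp (- x0) (- y0) (shiftp x0 y0 p) = p.
Proof. destruct p; unfold shiftp; simpl. rewrite !shiftS1_cancel; auto. Qed.

Lemma shiftk_valid x0 y0 k : valid k -> valid (shiftk x0 y0 k).
Proof. destruct k; auto. Qed.

Lemma on_shift f g x0 y0 k p : on f g k p -> on f g (shiftk x0 y0 k) (shiftp x0 y0 p).
Proof.
destruct k as [a b c|s t], p as [[x|] [y|]]; unfold shiftp; simpl fst; simpl snd; unfold shiftS1;
  try (simpl; intros; lra); try (simpl; tauto).
intros K. assert (x <> - b) by (simpl in K; tauto).
destruct (Rlt_le_dec 0 (x + b)).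
- apply on_right in K; auto. apply on_right. lra.
  replace (x + - x0 + (b + x0)) with (x + b) by ring. lra.
- apply on_left in K; [|lra]. apply on_left. lra.
  replace (- (x + - x0) - (b + x0)) with (- x - b) by ring. lra.
Qed.

Lemma slope_shift d e x0 y0 k x : slope d e (shiftk x0 y0 k) (x - x0) = slope d e k x.
Proof.
destruct k as [a b c|s t]; simpl; auto.
replace (x - x0 + (b + x0)) with (x + b) by ring.
replace (- (x - x0) - (b + x0)) with (- x - b) by ring.
destruct (Rlt_dec (- (b + x0)) (x - x0)), (Rlt_dec (- b) x); auto; lra.
Qed.

Lemma touch_finite f g d e m x0 y0 q : sh f d -> sh g e -> 0 < m ->
  fst q <> Some x0 -> snd q <> Some y0 ->
  exists k, valid k /\ on f g k (Some x0, Some y0) /\ slope d e k x0 = - m /\ on f g k q /\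
    forall k', valid k' -> on f g k' (Some x0, Some y0) -> slope d e k' x0 = - m ->
      on f g k' q -> k' = k.
Proof.
intros H G Hm Nx Ny.
assert (O : shiftp x0 y0 (Some x0, Some y0) = (Some 0, Some 0))
  by (unfold shiftp; simpl; do 2 f_equal; ring).
assert (O' : shiftp (- x0) (- y0) (Some 0, Some 0) = (Some x0, Some y0))
  by (unfold shiftp; simpl; do 2 f_equal; ring).
assert (N : forall z t, z <> Some t -> shiftS1 (- t) z <> Some 0).
{ intros [z|] t Hz; simpl; [|discriminate]. intros K. injection K as K. apply Hz. f_equal; lra. }
destruct (touch_origin f g d e m (shiftp x0 y0 q)) as (k & (V & K & S) & Q & U); auto;
  try (apply N; auto).
exists (shiftk (- x0) (- y0) k).
apply (on_shift _ _ (- x0) (- y0)) in K, Q. rewrite shiftp_cancel in Q. rewrite O' in K.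
split; [|split; [|split; [|split]]]; auto using shiftk_valid.
- rewrite <- S, <- (slope_shift d e (- x0) (- y0) k 0). f_equal. ring.
- intros k' V' K' S' Q'. apply (on_shift _ _ x0 y0) in K', Q'. rewrite O in K'.
  rewrite <- (U (shiftk x0 y0 k')). rewrite shiftk_cancel; auto.
  + split; [|split]; auto using shiftk_valid.
    rewrite <- S', <- (slope_shift d e x0 y0 k' x0). f_equal. ring.
  + auto.
Qed.

(** * Slopes, and crossing at a finite common point *)

Lemma derivable_pt_lim_shift f b x l : derivable_pt_lim f (x + b) l ->
  derivable_pt_lim (fun z => f (z + b)) x l.
Proof.
intros K. replace l with (l * (1 + 0)) by ring.
apply (derivable_pt_lim_comp (fun z => z + b) f); auto.
apply (derivable_pt_lim_plus (fun z => z) (fun _ => b)).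
apply derivable_pt_lim_id. apply derivable_pt_lim_const.
Qed.

Lemma derivable_pt_lim_reflect f x l : derivable_pt_lim f (- x) l ->
  derivable_pt_lim (fun z => f (- z)) x (- l).
Proof.
intros K. replace (- l) with (l * - 1) by ring.
apply (derivable_pt_lim_comp (fun z => - z) f); auto.
apply (derivable_pt_lim_opp (fun z => z)), derivable_pt_lim_id.
Qed.

Lemma derivable_pt_lim_affine f a c x l : derivable_pt_lim f x l ->
  derivable_pt_lim (fun z => a * f z + c) x (a * l).
Proof.
intros K. replace (a * l) with (a * l + 0) by ring.
apply (derivable_pt_lim_plus (fun z => a * f z) (fun _ => c)).
apply derivable_pt_lim_scal; auto. apply derivable_pt_lim_const.
Qed.

(** The values of [h] are in the circle, so its derivative is that of a real function [r]
    representing it near [x0]. *)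
Definition smooth_at (h : S1 -> S1) (x0 y0 s : R) : Prop :=
  exists r del, 0 < del /\ r x0 = y0 /\ derivable_pt_lim r x0 s /\
    forall x, Rabs (x - x0) < del -> h (Some x) = Some (r x).

Lemma circ_fun_smooth f g d e k x0 y0 : sh f d -> sh g e -> valid k ->
  on f g k (Some x0, Some y0) ->
  smooth_at (circ_fun f g k) x0 y0 (slope d e k x0) /\ slope d e k x0 < 0.
Proof.
intros H G V K. destruct k as [a b c|s t].
- simpl in V. unfold slope.
  destruct (hyp_cases _ _ _ _ _ _ _ _ _ H G V K) as [(A & B & C)|(A & B & C)];
    destruct (Rlt_dec (- b) x0); try lra.
  + split; [|assert (P := sh_dpos _ _ H (x0 + b) A); nra].
    exists (fun x => a * f (x + b) + c), (x0 + b). split; [auto|split; [auto|split]].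
    * replace (- (a * d (x0 + b))) with (a * - d (x0 + b)) by ring.
      apply (derivable_pt_lim_affine (fun x => f (x + b))), derivable_pt_lim_shift, sh_der; auto.
    * intros x Hx. apply Rabs_def2 in Hx.
      symmetry. apply (on_circ_fun f g (Hyp a b c) (Some x, Some _)), on_right; lra.
  + split; [|assert (P := sh_dpos _ _ G (- x0 - b) A); nra].
    exists (fun x => - a * g (- x - b) + c), (- x0 - b). split; [auto|split; [auto|split]].
    * replace (- (a * e (- x0 - b))) with (- a * - (- e (- x0 - b))) by ring.
      apply (derivable_pt_lim_affine (fun x => g (- x - b))).
      apply (derivable_pt_lim_reflect (fun x => g (x + - b))), derivable_pt_lim_shift, sh_der; auto.
    * intros x Hx. apply Rabs_def2 in Hx.
      symmetry. apply (on_circ_fun f g (Hyp a b c) (Some x, Some _)), on_left; lra.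
- simpl in *. split; auto. exists (fun x => s * x + t), 1.
  split; [lra|split; [auto|split; [|auto]]].
  assert (D := derivable_pt_lim_affine _ s t x0 1 (derivable_pt_lim_id x0)).
  rewrite Rmult_1_r in D. exact D.
Qed.

Lemma smooth_reflect h x0 y0 s : smooth_at h (- x0) y0 s ->
  smooth_at (fun z => h (negS1 z)) x0 y0 (- s).
Proof.
intros (r & del & Hd & E & D & L). exists (fun x => r (- x)), del. split; [auto|split; [auto|split]].
- apply derivable_pt_lim_reflect; auto.
- intros x Hx. apply L. replace (- x - - x0) with (- (x - x0)) by ring. rewrite Rabs_Ropp; auto.
Qed.

Lemma same_sign q s eps : Rabs (q - s) < eps -> eps <= Rabs s -> 0 < q * s.
Proof.
intros A B. apply Rabs_def2 in A. unfold Rabs in B. destruct (Rcase_abs s); nra.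
Qed.

Lemma smooth_quotient h x0 y0 s eps : smooth_at h x0 y0 s -> 0 < eps ->
  exists del, 0 < del /\ forall w, w <> 0 -> Rabs w < del ->
    exists q, Rabs (q - s) < eps /\ h (Some (x0 + w)) = Some (y0 + q * w).
Proof.
intros (r & del & Hd & E & D & L) He. destruct (D eps He) as [[del' Hd'] D']; simpl in D'.
exists (Rmin del del'). split. apply Rmin_pos; auto.
intros w Nw Hw.
assert (W1 := Rlt_le_trans _ _ _ Hw (Rmin_l _ _)).
assert (W2 := Rlt_le_trans _ _ _ Hw (Rmin_r _ _)).
exists ((r (x0 + w) - r x0) / w). split; auto.
rewrite L by (replace (x0 + w - x0) with w by ring; auto).
f_equal. rewrite <- E. field; auto.
Qed.

(* In the charts [-1/u] at [x0] and [y0] the curves become asymptotically [u / s1] and [u / s2]. *)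
Lemma slope_cross_ordered h1 h2 x0 y0 s1 s2 :
  S1_homeomorphism h1 -> S1_homeomorphism h2 ->
  smooth_at h1 x0 y0 s1 -> smooth_at h2 x0 y0 s2 -> 0 < (s2 - s1) * s1 * s2 ->
  exists z, z <> Some x0 /\ h1 z = h2 z.
Proof.
intros H1 H2 S1' S2' Hs.
assert (N1 : s1 <> 0) by (intros ->; lra).
assert (N2 : s2 <> 0) by (intros ->; lra).
assert (N3 : s2 - s1 <> 0) by (intros K; rewrite K in Hs; lra).
assert (P1 := Rabs_pos_lt _ N1). assert (P2 := Rabs_pos_lt _ N2). assert (P3 := Rabs_pos_lt _ N3).
(* Difference quotients within [eps] of the slopes keep the signs of the slopes, and their
   difference, off by less than [2 * eps], keeps the sign of [s2 - s1]. *)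
set (eps := Rmin (Rmin (Rabs s1) (Rabs s2)) (Rabs (s2 - s1) / 2)).
assert (E1 := Rmin_l (Rmin (Rabs s1) (Rabs s2)) (Rabs (s2 - s1) / 2)).
assert (E2 := Rmin_r (Rmin (Rabs s1) (Rabs s2)) (Rabs (s2 - s1) / 2)).
assert (E3 := Rmin_l (Rabs s1) (Rabs s2)). assert (E4 := Rmin_r (Rabs s1) (Rabs s2)).
assert (He : 0 < eps) by (unfold eps; repeat apply Rmin_pos; lra).
fold eps in E1, E2. clearbody eps.
destruct (smooth_quotient _ _ _ _ _ S1' He) as (d1 & D1 & Q1).
destruct (smooth_quotient _ _ _ _ _ S2' He) as (d2 & D2 & Q2).
set (w := Rmin d1 d2 / 2).
assert (M1 := Rmin_l d1 d2). assert (M2 := Rmin_r d1 d2).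
assert (M3 : 0 < Rmin d1 d2) by (apply Rmin_pos; auto).
(* Over the chart abscissa [- / w] the chart ordinates are [- / (q1 * w)] and [- / (q2 * w)]. Their
   difference has the sign of [- w], so [w] and [- w] give the required sign change. *)
assert (key : forall w, w <> 0 -> Rabs w < Rmin d1 d2 -> exists a1 a2,
  shiftS1 x0 (invS1 (Some (- / w))) = Some (x0 + w) /\
  invS1 (shiftS1 (- y0) (h1 (Some (x0 + w)))) = Some a1 /\
  invS1 (shiftS1 (- y0) (h2 (Some (x0 + w)))) = Some a2 /\
  exists r, 0 < r /\ a1 - a2 = - r / w).
{ clear w. intros w Nw Hw.
  destruct (Q1 w Nw ltac:(lra)) as (q1 & A1 & B1).
  destruct (Q2 w Nw ltac:(lra)) as (q2 & A2 & B2).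
  assert (G1 := same_sign _ _ _ A1 ltac:(lra)).
  assert (G2 := same_sign _ _ _ A2 ltac:(lra)).
  assert (G3 : 0 < (q2 - q1) * (s2 - s1)).
  { apply same_sign with (2 * eps); [|lra].
    apply Rabs_def2 in A1, A2. apply Rabs_def1; lra. }
  assert (G : 0 < (q2 - q1) * q1 * q2).
  { apply Rmult_lt_reg_r with ((s2 - s1) * s1 * s2); auto. rewrite Rmult_0_l.
    replace ((q2 - q1) * q1 * q2 * ((s2 - s1) * s1 * s2))
      with ((q2 - q1) * (s2 - s1) * (q1 * s1) * (q2 * s2)) by ring.
    apply Rmult_lt_0_compat; [apply Rmult_lt_0_compat|]; auto. }
  assert (q1 <> 0) by (intros ->; lra). assert (q2 <> 0) by (intros ->; lra).
  assert (Nw' : - / w <> 0) by (apply Ropp_neq_0_compat, Rinv_neq_0_compat; auto).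
  exists (- / (q1 * w)), (- / (q2 * w)). split; [|split; [|split]].
  - rewrite invS1_Some by auto. simpl. f_equal. field. auto.
  - rewrite B1. simpl shiftS1. replace (y0 + q1 * w + - y0) with (q1 * w) by ring.
    apply invS1_Some. apply Rmult_integral_contrapositive; auto.
  - rewrite B2. simpl shiftS1. replace (y0 + q2 * w + - y0) with (q2 * w) by ring.
    apply invS1_Some. apply Rmult_integral_contrapositive; auto.
  - exists ((q2 - q1) * q1 * q2 / (q1 * q2 * (q1 * q2))). split.
    + apply Rdiv_lt_0_compat; auto. apply Rsqr_pos_lt, Rmult_integral_contrapositive; auto.
    + field. auto. }
assert (W : 0 < w < Rmin d1 d2) by (unfold w; lra). clearbody w.
assert (Aw : Rabs w < Rmin d1 d2) by (rewrite Rabs_pos_eq; lra).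
assert (Aw' : Rabs (- w) < Rmin d1 d2) by (rewrite Rabs_Ropp; auto).
destruct (key w ltac:(lra) Aw) as (a1 & a2 & X & Y1 & Y2 & r & Hr & Er).
destruct (key (- w) ltac:(lra) Aw') as (b1 & b2 & X' & Z1 & Z2 & r' & Hr' & Er').
assert (T : 0 < r / w) by (apply Rdiv_lt_0_compat; lra).
assert (T' : 0 < r' / w) by (apply Rdiv_lt_0_compat; lra).
assert (Ea : - r / w = - (r / w)) by (field; lra).
assert (Eb : - r' / - w = r' / w) by (field; lra).
apply (homeo_cross_charts (fun z => shiftS1 x0 (invS1 z)) (fun z => invS1 (shiftS1 (- y0) z))
  (Some x0) h1 h2 (- / w) (- / - w) a1 a2 b1 b2); auto;
  try (rewrite X; auto; fail); try (rewrite X'; auto; fail); try lra.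
- apply (homeo_comp (shiftS1 x0)). apply shiftS1_homeo. apply invS1_homeo.
- apply (homeo_comp invS1). apply invS1_homeo. apply shiftS1_homeo.
- simpl. f_equal; ring.
- destruct S1' as (r1 & del & Hdel & R1 & _ & L). rewrite L, R1.
  simpl shiftS1. rewrite Rplus_opp_r. apply invS1_0. rewrite Rminus_diag, Rabs_R0; auto.
- destruct S2' as (r2 & del & Hdel & R2 & _ & L). rewrite L, R2.
  simpl shiftS1. rewrite Rplus_opp_r. apply invS1_0. rewrite Rminus_diag, Rabs_R0; auto.
Qed.

Lemma slope_cross h1 h2 x0 y0 s1 s2 :
  S1_homeomorphism h1 -> S1_homeomorphism h2 ->
  smooth_at h1 x0 y0 s1 -> smooth_at h2 x0 y0 s2 -> s1 <> 0 -> s2 <> 0 -> s1 <> s2 ->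
  exists z, z <> Some x0 /\ h1 z = h2 z.
Proof.
intros H1 H2 K1 K2 N1 N2 N.
assert (P : (s2 - s1) * s1 * s2 <> 0)
  by (repeat apply Rmult_integral_contrapositive_currified; auto; lra).
destruct (Rtotal_order ((s2 - s1) * s1 * s2) 0) as [L|[L|L]]; try lra.
- destruct (slope_cross_ordered h2 h1 x0 y0 s2 s1) as (z & Nz & E); auto. lra. eauto.
- eapply slope_cross_ordered; eauto.
Qed.

(** * Crossing at a common point with one infinite coordinate *)

Lemma id_homeo : S1_homeomorphism (fun z => z).
Proof. exists (fun z => z). split; [|split; [|split]]; auto; intros U HU; exact HU. Qed.

(** Only the ordinate needs a chart here; [p1], [p2], [q1], [q2] are heights over the common value
    [c] at infinity, and their negated inverses are the chart ordinates. *)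
Lemma cross_asym h1 h2 c u v p1 p2 q1 q2 :
  S1_homeomorphism h1 -> S1_homeomorphism h2 -> h1 None = Some c -> h2 None = Some c ->
  h1 (Some u) = Some (p1 + c) -> h2 (Some u) = Some (p2 + c) -> p1 <> 0 -> p2 <> 0 ->
  - / p1 < - / p2 ->
  h1 (Some v) = Some (q1 + c) -> h2 (Some v) = Some (q2 + c) -> q1 <> 0 -> q2 <> 0 ->
  - / q2 < - / q1 ->
  exists z, z <> None /\ h1 z = h2 z.
Proof.
intros H1 H2 N1 N2 U1 U2 P1 P2 L V1 V2 Q1 Q2 L'.
assert (F : forall p, p <> 0 -> invS1 (shiftS1 (- c) (Some (p + c))) = Some (- / p)).
{ intros p Hp. simpl shiftS1. replace (p + c + - c) with p by ring. apply invS1_Some; auto. }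
apply (homeo_cross_charts (fun z => z) (fun z => invS1 (shiftS1 (- c) z)) None h1 h2 u v
  (- / p1) (- / p2) (- / q1) (- / q2)); auto using id_homeo.
- apply (homeo_comp invS1). apply invS1_homeo. apply shiftS1_homeo.
- rewrite N1. simpl shiftS1. rewrite Rplus_opp_r. apply invS1_0.
- rewrite N2. simpl shiftS1. rewrite Rplus_opp_r. apply invS1_0.
- rewrite U1; auto.
- rewrite U2; auto.
- rewrite V1; auto.
- rewrite V2; auto.
Qed.

Lemma cross_pole h1 h2 x0 u v p1 p2 q1 q2 :
  S1_homeomorphism h1 -> S1_homeomorphism h2 -> h1 (Some x0) = None -> h2 (Some x0) = None ->
  u <> 0 -> h1 (Some (x0 + u)) = Some p1 -> h2 (Some (x0 + u)) = Some p2 -> p1 < p2 ->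
  v <> 0 -> h1 (Some (x0 + v)) = Some q1 -> h2 (Some (x0 + v)) = Some q2 -> q2 < q1 ->
  exists z, z <> Some x0 /\ h1 z = h2 z.
Proof.
intros H1 H2 N1 N2 Nu U1 U2 L Nv V1 V2 L'.
assert (F : forall w, w <> 0 -> shiftS1 x0 (invS1 (Some (- / w))) = Some (x0 + w)).
{ intros w Hw.
  assert (Nw' : - / w <> 0) by (apply Ropp_neq_0_compat, Rinv_neq_0_compat; auto).
  rewrite invS1_Some by auto. simpl. f_equal. field. auto. }
apply (homeo_cross_charts (fun z => shiftS1 x0 (invS1 z)) (fun z => z) (Some x0) h1 h2
  (- / u) (- / v) p1 p2 q1 q2); auto using id_homeo.
- apply (homeo_comp (shiftS1 x0)). apply shiftS1_homeo. apply invS1_homeo.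
- simpl. f_equal; ring.
- rewrite F; auto.
- rewrite F; auto.
- rewrite F; auto.
- rewrite F; auto.
Qed.

Lemma circ_fun_right f g a b c x : 0 < x + b ->
  circ_fun f g (Hyp a b c) (Some x) = Some (a * f (x + b) + c).
Proof.
intros L. symmetry. apply (on_circ_fun f g (Hyp a b c) (Some x, Some _)), on_right; auto.
Qed.

Lemma circ_fun_left f g a b c x : 0 < - x - b ->
  circ_fun f g (Hyp a b c) (Some x) = Some (- (a * g (- x - b)) + c).
Proof.
intros L. symmetry. apply (on_circ_fun f g (Hyp a b c) (Some x, Some _)), on_left; auto. ring.
Qed.

Lemma circ_fun_pole f g a b c : circ_fun f g (Hyp a b c) (Some (- b)) = None.
Proof. simpl. destruct (Req_dec_T (- b) (- b)); tauto. Qed.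

Lemma neg_inv_lt_pos p q : 0 < q -> q < p -> - / q < - / p.
Proof. intros; apply neg_inv_incr; auto. Qed.

(** Far out a translation changes [f] by a factor near 1, which cannot compensate the larger scale
    [a]. The [+ 1] in the shift keeps it positive when [b = b']. *)
Lemma sh_scaled_tail f d a b a' b' : sh f d -> 0 < a' -> a' < a ->
  exists u, 0 < u + b /\ 0 < u + b' /\ a' * f (u + b') < a * f (u + b).
Proof.
intros H Ha' Ha.
destruct (sh_ratio _ _ H (Rabs (b - b') + 1) (a' / a)) as (N & HN).
{ assert (P := Rabs_pos (b - b')). lra. }
{ apply Rmult_lt_reg_r with a. lra. unfold Rdiv. rewrite Rmult_assoc, Rinv_l; lra. }
set (x := Rmax N (Rabs (b - b')) + 1).
assert (M1 := Rmax_l N (Rabs (b - b'))). assert (M2 := Rmax_r N (Rabs (b - b'))).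
assert (A1 := Rle_abs (b - b')). assert (A2 := Rle_abs (- (b - b'))). rewrite Rabs_Ropp in A2.
assert (P := Rabs_pos (b - b')).
specialize (HN x ltac:(unfold x; lra) ltac:(unfold x; lra)).
exists (x - b'). assert (X : x - b' + b' = x) by ring. rewrite X.
assert (X0 : 0 < x - b' + b) by (unfold x; lra).
repeat split; auto. unfold x; lra.
assert (D := sh_decr _ _ H (x - b' + b) (x + (Rabs (b - b') + 1)) X0 ltac:(lra)).
apply Rmult_lt_compat_l with (r := a) in HN, D; try lra.
replace (a * (a' / a * f x)) with (a' * f x) in HN by (field; lra). lra.
Qed.

(** The circle of larger scale is farther from the common asymptote at both ends. As the two arms
    lie on opposite sides of the asymptote, the chart ordinates differ with opposite signs. *)
Lemma hyp_cross_asym f g d e a b a' b' c : sh f d -> sh g e -> 0 < a' -> a' < a ->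
  exists z, z <> None /\ circ_fun f g (Hyp a b c) z = circ_fun f g (Hyp a' b' c) z.
Proof.
intros H G Ha' Ha.
destruct (sh_scaled_tail _ _ a b a' b' H Ha' Ha) as (u & U1 & U2 & U).
destruct (sh_scaled_tail _ _ a (- b) a' (- b') G Ha' Ha) as (v & V1 & V2 & V).
assert (P1 := sh_pos _ _ H _ U2). assert (P2 := sh_pos _ _ G _ V2).
replace (v + - b) with (- - v - b) in * by ring.
replace (v + - b') with (- - v - b') in * by ring.
apply Rmult_lt_0_compat with (r1 := a') in P1, P2; auto.
apply (cross_asym _ _ c (- v) u (- (a * g (- - v - b))) (- (a' * g (- - v - b')))
  (a * f (u + b)) (a' * f (u + b'))); try lra; auto.
- apply (circ_fun_homeo f d g e); simpl; auto; lra.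
- apply (circ_fun_homeo f d g e); simpl; auto; lra.
- apply circ_fun_left; auto.
- apply circ_fun_left; auto.
- rewrite !Rinv_opp. assert (K := neg_inv_lt_pos _ _ P2 V). lra.
- apply circ_fun_right; auto.
- apply circ_fun_right; auto.
- apply neg_inv_lt_pos; auto.
Qed.

(** Close to the common pole the difference of scales outweighs the difference of [c] and [c']: the
    first circle is above on the right and below on the left. *)
Lemma hyp_cross_pole f g d e a b c a' c' : sh f d -> sh g e -> 0 < a' -> a' < a ->
  exists z, z <> Some (- b) /\ circ_fun f g (Hyp a b c) z = circ_fun f g (Hyp a' b c') z.
Proof.
intros H G Ha' Ha.
destruct (sh_zero_mult _ _ H (c' - c) (a - a') 1 ltac:(lra) ltac:(lra)) as (u & U1 & U).
destruct (sh_zero_mult _ _ G (c - c') (a - a') 1 ltac:(lra) ltac:(lra)) as (v & V1 & V).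
assert (Eu : - b + u + b = u) by ring.
assert (Ev : - (- b + - v) - b = v) by ring.
apply (cross_pole _ _ (- b) (- v) u (- (a * g v) + c) (- (a' * g v) + c')
  (a * f u + c) (a' * f u + c')); try lra; auto using circ_fun_pole.
- apply (circ_fun_homeo f d g e); simpl; auto; lra.
- apply (circ_fun_homeo f d g e); simpl; auto; lra.
- rewrite circ_fun_left, Ev; auto; lra.
- rewrite circ_fun_left, Ev; auto; lra.
- rewrite circ_fun_right, Eu; auto; lra.
- rewrite circ_fun_right, Eu; auto; lra.
Qed.

(** * The two families of circles *)

Lemma Cminus_iff f g D : Cminus f g D <-> exists k, valid k /\ same_set D (on f g k).
Proof.
split.
- intros [(a & b & c & A & E)|(s & t & A & E)].
  exists (Hyp a b c); auto. exists (Lin s t); auto.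
- intros ([a b c|s t] & V & E); [left|right]; eauto.
Qed.

Lemma phi_involutive p : phi (phi p) = p.
Proof. destruct p; unfold phi; simpl. rewrite negS1_involutive; auto. Qed.

Lemma Cplus_iff f g D : Cplus f g D <-> exists k, valid k /\ same_set D (fun p => on f g k (phi p)).
Proof.
unfold Cplus. split.
- intros (E & C & S). apply Cminus_iff in C. destruct C as (k & V & K).
  exists k. split; auto. intros p. rewrite (S p). split.
  + intros (q & Q & ->). rewrite phi_involutive. apply K; auto.
  + intros P. exists (phi p). rewrite phi_involutive. split; auto. apply K; auto.
- intros (k & V & S). exists (on f g k). split.
  + apply Cminus_iff. exists k. split; auto. intros p; tauto.
  + intros p. rewrite (S p). split.
    * intros P. exists (phi p). rewrite phi_involutive. auto.
    * intros (q & Q & ->). rewrite phi_involutive. auto.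
Qed.

Definition circles (f1 f2 f3 f4 : R -> R) (D : Pt -> Prop) : Prop :=
  Cminus f1 f2 D \/ Cplus f3 f4 D.

Lemma circles_flip f1 f2 f3 f4 D :
  circles f1 f2 f3 f4 D <-> circles f3 f4 f1 f2 (fun p => D (phi p)).
Proof.
unfold circles. rewrite !Cminus_iff, !Cplus_iff.
split; (intros [(k & V & S)|(k & V & S)]; [right|left]); exists k; (split; [auto|]); intros p;
  assert (T := S (phi p)); cbv beta in *; rewrite ?phi_involutive in T; tauto.
Qed.

Lemma parallel_flip p q : parallel (phi p) (phi q) <-> parallel p q.
Proof.
unfold parallel, plus_parallel, minus_parallel. simpl. split; intros [E|E]; auto; left.
- rewrite <- (negS1_involutive (fst p)), <- (negS1_involutive (fst q)), E. auto.
- rewrite E; auto.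
Qed.

Lemma below_total x y : x <> y -> below x y \/ below y x.
Proof.
destruct x as [x|], y as [y|]; simpl; auto. intros N.
destruct (Rtotal_order x y) as [L|[L|L]]; auto. subst; tauto.
Qed.

Lemma cyc_total x y z : x <> y -> x <> z -> y <> z -> cyc x y z \/ cyc z y x.
Proof.
intros A B C. unfold cyc.
apply below_total in A, B, C. tauto.
Qed.

Lemma below_asym x y : below x y -> below y x -> False.
Proof. destruct x, y; simpl; auto; lra. Qed.

Lemma cyc_asym x y z : cyc x y z -> cyc z y x -> False.
Proof.
unfold cyc. assert (A := below_asym x y). assert (B := below_asym y z).
assert (C := below_asym z x). tauto.
Qed.

(** * Joining and touching in the union of the two families *)

Definition joinable (Cs : (Pt -> Prop) -> Prop) (p q r : Pt) : Prop :=
  exists C, Cs C /\ C p /\ C q /\ C r /\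
    forall D, Cs D -> D p -> D q -> D r -> same_set D C.

Lemma joinable_reverse Cs p q r : joinable Cs r q p -> joinable Cs p q r.
Proof. intros (C & H & A & B & D & U). exists C. repeat split; auto; apply U; auto. Qed.

Lemma joinable_flip f1 f2 f3 f4 p q r :
  joinable (circles f3 f4 f1 f2) (phi p) (phi q) (phi r) -> joinable (circles f1 f2 f3 f4) p q r.
Proof.
intros (C & H & A & B & D & U). exists (fun p => C (phi p)).
split; [apply circles_flip in H; auto|]. do 3 (split; [auto|]).
intros E HE Ep Eq Er x. apply circles_flip in HE.
rewrite <- (phi_involutive x) at 1.
apply (U (fun p => E (phi p))); auto; rewrite phi_involutive; auto.
Qed.

Lemma joinable_neg f1 f2 f3 f4 d1 d2 d3 d4 p q r :
  sh f1 d1 -> sh f2 d2 -> sh f3 d3 -> sh f4 d4 ->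
  cyc (fst p) (fst q) (fst r) -> cyc (snd r) (snd q) (snd p) ->
  joinable (circles f1 f2 f3 f4) p q r.
Proof.
intros H1 H2 H3 H4 X Y.
destruct (joins_neg f1 d1 f2 d2 p q r) as (k & V & P & Q & S & U); auto.
exists (on f1 f2 k). split.
{ left. apply Cminus_iff. exists k. split; auto. intros z; tauto. }
do 3 (split; [auto|]).
intros D [HD|HD] Dp Dq Dr.
- apply Cminus_iff in HD. destruct HD as (k' & V' & E).
  rewrite <- (U k'); auto; apply E; auto.
- exfalso. apply Cplus_iff in HD. destruct HD as (k' & V' & E).
  apply E in Dp, Dq, Dr. apply on_circ_fun in Dp, Dq, Dr. simpl in Dp, Dq, Dr.
  apply negS1_cyc in X. apply (circ_fun_cyc f3 d3 f4 d4 k') in X; auto.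
  rewrite <- Dp, <- Dq, <- Dr in X. eapply cyc_asym; eauto.
Qed.

Lemma joinable_all f1 f2 f3 f4 d1 d2 d3 d4 p q r :
  sh f1 d1 -> sh f2 d2 -> sh f3 d3 -> sh f4 d4 ->
  ~ parallel p q -> ~ parallel p r -> ~ parallel q r ->
  joinable (circles f1 f2 f3 f4) p q r.
Proof.
intros H1 H2 H3 H4. unfold parallel, plus_parallel, minus_parallel. intros A B C.
destruct (cyc_total (fst p) (fst q) (fst r)) as [X|X]; try tauto;
  destruct (cyc_total (snd p) (snd q) (snd r)) as [Y|Y]; try tauto.
- apply joinable_flip, joinable_reverse. apply (joinable_neg f3 f4 f1 f2 d3 d4 d1 d2); auto.
  apply negS1_cyc; auto.
- apply (joinable_neg f1 f2 f3 f4 d1 d2 d3 d4); auto.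
- apply joinable_reverse. apply (joinable_neg f1 f2 f3 f4 d1 d2 d3 d4); auto.
- apply joinable_flip. apply (joinable_neg f3 f4 f1 f2 d3 d4 d1 d2); auto.
  apply negS1_cyc; auto.
Qed.

(** With [hyp_pole_exists]: for fixed [a] and [c] the horizontal translates partition the points not
    parallel to [(None, Some c)]. *)
Lemma hyp_pole_inj f d g e a b b' c x y : sh f d -> sh g e -> 0 < a ->
  on f g (Hyp a b c) (Some x, y) -> on f g (Hyp a b' c) (Some x, y) -> b = b'.
Proof.
intros H G Ha K K'. destruct y as [y|]; [|simpl in K, K'; lra].
destruct (hyp_cases _ _ _ _ _ _ _ _ _ H G Ha K) as [(A & B & C)|(A & B & C)];
  destruct (hyp_cases _ _ _ _ _ _ _ _ _ H G Ha K') as [(A' & B' & C')|(A' & B' & C')]; try lra.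
- assert (E : f (x + b) = f (x + b')) by (apply Rmult_eq_reg_l with a; lra).
  apply (sh_inj _ _ H) in E; auto; lra.
- assert (E : g (- x - b) = g (- x - b')) by (apply Rmult_eq_reg_l with a; lra).
  apply (sh_inj _ _ G) in E; auto; lra.
Qed.

Lemma hyp_pole_exists f d g e a c x y : sh f d -> sh g e -> 0 < a -> y <> Some c ->
  exists b, on f g (Hyp a b c) (Some x, y).
Proof.
intros H G Ha Ny. destruct y as [y|]; [|exists (- x); simpl; lra].
destruct (Rtotal_order y c) as [L|[L|L]]; [|subst; tauto|].
- destruct (sh_surj _ _ G ((c - y) / a)) as (u & Hu & E). apply Rdiv_lt_0_compat; lra.
  exists (- x - u). apply on_left. lra. replace (- x - (- x - u)) with u by ring.
  rewrite E. field; lra.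
- destruct (sh_surj _ _ H ((y - c) / a)) as (u & Hu & E). apply Rdiv_lt_0_compat; lra.
  exists (u - x). apply on_right. lra. replace (x + (u - x)) with u by ring.
  rewrite E. field; lra.
Qed.

(* An increasing and a decreasing homeomorphism of the circle never meet in exactly one point. *)
Lemma opposite_meet_again f1 f2 f3 f4 d1 d2 d3 d4 k k' p :
  sh f1 d1 -> sh f2 d2 -> sh f3 d3 -> sh f4 d4 -> valid k -> valid k' ->
  on f1 f2 k p -> on f3 f4 k' (phi p) ->
  exists z, z <> p /\ on f1 f2 k z /\ on f3 f4 k' (phi z).
Proof.
intros H1 H2 H3 H4 V V' P P'.
assert (K := circ_fun_homeo _ _ _ _ _ H1 H2 V).
assert (K' := homeo_comp _ _ (circ_fun_homeo _ _ _ _ _ H3 H4 V') negS1_homeo).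
set (h := circ_fun f1 f2 k) in *. set (h' := fun z => circ_fun f3 f4 k' (negS1 z)) in *.
assert (W : (exists z, z <> fst p /\ h z = h' z) ->
  exists z, z <> p /\ on f1 f2 k z /\ on f3 f4 k' (phi z)).
{ intros (z & Nz & E). exists (z, h z). split; [|split].
  - intros <-; auto.
  - apply on_circ_fun. auto.
  - apply on_circ_fun. exact E. }
apply W. clear W.
destruct p as [[x|] [y|]]; simpl fst.
- destruct (circ_fun_smooth _ _ _ _ _ _ _ H1 H2 V P) as (S & L).
  destruct (circ_fun_smooth _ _ _ _ _ _ _ H3 H4 V' P') as (S' & L').
  (* The reflection makes the slope of [h'] positive, while that of [h] is negative. *)
  apply smooth_reflect in S'.
  eapply slope_cross; eauto; lra.
- destruct k as [a b c|s t]; [|simpl in P; tauto].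
  destruct k' as [a' b' c'|s t]; [|simpl in P'; tauto].
  simpl in V, V', P, P'. subst x. assert (b' = - b) by lra. subst b'.
  (* Chosen so that just right of the pole [h] exceeds [c'] while [h'] stays below [c']; just left
     of it the roles are exchanged. *)
  destruct (sh_zero_mult _ _ H1 (c' - c) a 1 V ltac:(lra)) as (u & U1 & U).
  destruct (sh_zero_mult _ _ H2 (c - c') a 1 V ltac:(lra)) as (v & W1 & W).
  assert (Q := sh_pos _ _ H4 u ltac:(lra)). assert (Q' := sh_pos _ _ H3 v ltac:(lra)).
  apply Rmult_lt_0_compat with (r1 := a') in Q, Q'; auto.
  assert (E1 : - b + u + b = u) by ring. assert (E2 : - (- b + - v) - b = v) by ring.
  assert (E3 : - - (- b + u) - - b = u) by ring. assert (E4 : - (- b + - v) + - b = v) by ring.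
  apply (cross_pole _ _ (- b) (- v) u (- (a * f2 v) + c) (a' * f3 v + c')
    (a * f1 u + c) (- (a' * f4 u) + c')); auto; try lra; unfold h, h', negS1.
  + apply circ_fun_pole.
  + apply circ_fun_pole.
  + rewrite circ_fun_left, E2; auto; lra.
  + rewrite circ_fun_right, E4; auto; lra.
  + rewrite circ_fun_right, E1; auto; lra.
  + rewrite circ_fun_left, E3; auto; lra.
- destruct k as [a b c|s t]; [|simpl in P; tauto].
  destruct k' as [a' b' c'|s t]; [|simpl in P'; tauto].
  simpl in V, V', P, P'. subst y. subst c'.
  (* Large enough for [u] and [- u] to lie outside both poles; there the two circles are on opposite
     sides of the common asymptote. *)
  set (u := Rabs b + Rabs b' + 1).
  assert (B1 := Rle_abs b). assert (B2 := Rle_abs b').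
  assert (B3 := Rle_abs (- b)). assert (B4 := Rle_abs (- b')). rewrite Rabs_Ropp in B3, B4.
  assert (B5 := Rabs_pos b). assert (B6 := Rabs_pos b').
  assert (U1 : 0 < u + b) by (unfold u; lra). assert (U2 : 0 < - - u - b') by (unfold u; lra).
  assert (U3 : 0 < - - u - b) by (unfold u; lra). assert (U4 : 0 < - - u + b') by (unfold u; lra).
  clearbody u. clear B1 B2 B3 B4 B5 B6.
  assert (Q1 := sh_pos _ _ H1 _ U1). assert (Q2 := sh_pos _ _ H4 _ U2).
  assert (Q3 := sh_pos _ _ H2 _ U3). assert (Q4 := sh_pos _ _ H3 _ U4).
  apply Rmult_lt_0_compat with (r1 := a) in Q1, Q3; auto.
  apply Rmult_lt_0_compat with (r1 := a') in Q2, Q4; auto.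
  assert (I1 := Rinv_0_lt_compat _ Q1). assert (I2 := Rinv_0_lt_compat _ Q2).
  assert (I3 := Rinv_0_lt_compat _ Q3). assert (I4 := Rinv_0_lt_compat _ Q4).
  apply (cross_asym _ _ c u (- u) (a * f1 (u + b)) (- (a' * f4 (- - u - b')))
    (- (a * f2 (- - u - b))) (a' * f3 (- - u + b'))); auto; try lra;
    rewrite ?Rinv_opp; try lra; unfold h, h', negS1.
  + apply circ_fun_right; auto.
  + apply circ_fun_left; auto.
  + apply circ_fun_left; auto.
  + apply circ_fun_right; auto.
- destruct k as [a b c|s t]; [simpl in P; tauto|].
  destruct k' as [a' b' c'|s' t']; [simpl in P'; tauto|].
  simpl in V, V'. exists (Some ((t' - t) / (s + s'))). split. discriminate.
  unfold h, h'. simpl. f_equal. field. lra.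
Qed.

(** At each kind of point [p] one class of circles through [p] partitions the points not parallel to
    [p]: circles of equal slope at a finite point, vertical translates at a pole, horizontal
    translates at an asymptote, parallel lines at [(None, None)]. The touching circle is the member
    through [q] of the class of [k], and the crossing lemmas force every touching circle into that
    class. *)
Lemma touch_core f1 f2 d1 d2 k p q : sh f1 d1 -> sh f2 d2 -> valid k ->
  on f1 f2 k p -> ~ on f1 f2 k q -> ~ parallel p q ->
  exists k1, valid k1 /\ on f1 f2 k1 p /\ on f1 f2 k1 q /\
    (forall z, on f1 f2 k z /\ on f1 f2 k1 z <-> z = p) /\
    forall k2, valid k2 -> on f1 f2 k2 p -> on f1 f2 k2 q ->
      (forall z, on f1 f2 k z -> on f1 f2 k2 z -> z = p) -> k2 = k1.
Proof.
intros H1 H2 V P NQ NP.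
assert (Nx : fst q <> fst p) by (intros E; apply NP; left; symmetry; exact E).
assert (Ny : snd q <> snd p) by (intros E; apply NP; right; symmetry; exact E).
assert (hom : forall k, valid k -> S1_homeomorphism (circ_fun f1 f2 k))
  by (intros; eapply circ_fun_homeo; eauto).
assert (meet : forall k2, (forall z, on f1 f2 k z -> on f1 f2 k2 z -> z = p) ->
  ~ exists z, z <> fst p /\ circ_fun f1 f2 k z = circ_fun f1 f2 k2 z).
{ intros k2 T (z & Nz & E). apply Nz.
  rewrite <- (T (z, circ_fun f1 f2 k z)); auto; apply on_circ_fun; auto. }
destruct p as [[x|] [y|]]; simpl fst in *; simpl snd in *.
- set (m := - slope d1 d2 k x).
  assert (Sm := circ_fun_smooth _ _ _ _ _ _ _ H1 H2 V P). destruct Sm as (Sm & L).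
  destruct (touch_finite f1 f2 d1 d2 m x y q) as (k1 & V1 & P1 & S1' & Q1 & U); auto.
  { unfold m; lra. }
  exists k1. split; [auto|split; [auto|split; [auto|split]]].
  + intros z. split; [intros [Z Z1]|intros ->; auto].
    (* If [k] and [k1] met again in [z], both would be the unique circle of this slope through [z],
       and [q] would lie on [k]. *)
    apply NNPP. intros Nz.
    assert (Zx : fst z <> Some x).
    { intros E. apply Nz. apply on_circ_fun in Z, P. simpl in P. rewrite E, <- P in Z.
      destruct z; simpl in *; congruence. }
    assert (Zy : snd z <> Some y).
    { intros E. apply Zx. apply on_circ_fun in Z, P. simpl in P.
      apply (homeo_inj _ (hom k V)). rewrite <- Z, <- P. auto. }
    destruct (touch_finite f1 f2 d1 d2 m x y z) as (k' & _ & _ & _ & _ & U'); auto.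
    { unfold m; lra. }
    apply NQ. rewrite (U' k); auto. rewrite <- (U' k1); auto. unfold m; ring.
  + intros k2 V2 P2 Q2 T. apply U; auto.
    destruct (circ_fun_smooth _ _ _ _ _ _ _ H1 H2 V2 P2) as (Sm2 & L2).
    destruct (Req_dec (slope d1 d2 k2 x) (slope d1 d2 k x)) as [E|N].
    rewrite E; unfold m; ring.
    exfalso. apply (meet k2 T). eapply slope_cross; eauto; lra.
- destruct k as [a b c|s t]; [|simpl in P; tauto].
  assert (b = - x) by (simpl in P; lra). subst b. simpl in V.
  destruct q as [qx [qy|]]; simpl in Nx, Ny; try tauto.
  assert (Ec : exists c1, on f1 f2 (Hyp a (- x) c1) (qx, Some qy)).
  { destruct qx as [qx|]; [|exists qy; simpl; auto].
    exists (c + (qy - fabc f1 f2 a (- x) c qx)). simpl. split.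
    - intros ->. apply Nx. f_equal. ring.
    - unfold fabc. destruct (Rlt_dec (- - x) qx); ring. }
  assert (Uc : forall c1 c2 z, z <> (Some x, None) ->
    on f1 f2 (Hyp a (- x) c1) z -> on f1 f2 (Hyp a (- x) c2) z -> c1 = c2).
  { intros c1 c2 [[zx|] [zy|]] Nz; simpl; intros A B; try congruence.
    - unfold fabc in *. destruct (Rlt_dec (- - x) zx); lra.
    - exfalso. apply Nz. do 2 f_equal. lra. }
  destruct Ec as (c1 & E1). exists (Hyp a (- x) c1).
  split; [auto|split; [exact P|split; [auto|split]]].
  + intros z. split; [intros [Z Z1]|intros ->; auto].
    apply NNPP. intros Nz. apply NQ. rewrite (Uc c c1 z); auto.
  + intros [a2 b2 c2|s t] V2 P2 Q2 T; [|simpl in P2; tauto].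
    assert (b2 = - x) by (simpl in P2; lra). subst b2. simpl in V2.
    assert (a2 = a).
    { assert (M : ~ exists z, z <> Some (- - x) /\
        circ_fun f1 f2 (Hyp a (- x) c) z = circ_fun f1 f2 (Hyp a2 (- x) c2) z)
        by (rewrite Ropp_involutive; exact (meet _ T)).
      destruct (Rtotal_order a2 a) as [L|[L|L]]; auto; exfalso; apply M.
      - eapply hyp_cross_pole; eauto.
      - destruct (hyp_cross_pole f1 f2 d1 d2 a2 (- x) c2 a c) as (z & Nz & E); auto; try lra.
        exists z; auto. }
    subst a2. f_equal. apply (Uc c2 c1 (qx, Some qy)); auto. congruence.
- destruct k as [a b c|s t]; [|simpl in P; tauto].
  assert (c = y) by (simpl in P; auto). subst y. simpl in V.
  destruct q as [[qx|] qy]; simpl in Nx, Ny; try tauto.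
  destruct (hyp_pole_exists f1 d1 f2 d2 a c qx qy) as (b1 & E1); auto.
  exists (Hyp a b1 c). split; [auto|split; [exact P|split; [auto|split]]].
  + intros [[zx|] zy]; split; [intros [Z Z1]|intros Z; try discriminate|intros [Z Z1]|intros Z].
    * exfalso. apply NQ. rewrite (hyp_pole_inj f1 d1 f2 d2 a b b1 c zx zy); auto.
    * destruct zy; simpl in Z; [subst; auto | tauto].
    * rewrite Z. auto.
  + intros [a2 b2 c2|s t] V2 P2 Q2 T; [|simpl in P2; tauto].
    assert (c2 = c) by (simpl in P2; auto). subst c2. simpl in V2.
    assert (a2 = a).
    { destruct (Rtotal_order a2 a) as [L|[L|L]]; auto; exfalso; apply (meet _ T).
      - eapply hyp_cross_asym; eauto.
      - destruct (hyp_cross_asym f1 f2 d1 d2 a2 b2 a b c) as (z & Nz & E); auto; try lra.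
        exists z; auto. }
    subst a2. f_equal. apply (hyp_pole_inj f1 d1 f2 d2 a b2 b1 c qx qy); auto.
- destruct k as [a b c|s t]; [simpl in P; tauto|]. simpl in V.
  destruct q as [[qx|] [qy|]]; simpl in Nx, Ny; try tauto.
  exists (Lin s (qy - s * qx)). split; [auto|split; [auto|split; [simpl; ring|split]]].
  + intros [[zx|] [zy|]]; split; simpl; try tauto; try discriminate.
    intros [A B]. exfalso. apply NQ. simpl. lra.
  + intros [a2 b2 c2|s2 t2] V2 P2 Q2 T; [simpl in P2; tauto|]. simpl in Q2.
    assert (s2 = s).
    { apply NNPP. intros N. apply (meet _ T). exists (Some ((t2 - t) / (s - s2))).
      split. discriminate. simpl. f_equal. field. lra. }
    subst s2. f_equal. lra.
Qed.

Definition touchable (Cs : (Pt -> Prop) -> Prop) (C : Pt -> Prop) (p q : Pt) : Prop :=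
  exists D, Cs D /\ D p /\ D q /\ (forall z, C z /\ D z <-> z = p) /\
    forall E, Cs E -> E p -> E q -> (forall z, C z /\ E z <-> z = p) -> same_set E D.

Lemma touchable_flip f1 f2 f3 f4 C p q :
  touchable (circles f3 f4 f1 f2) (fun z => C (phi z)) (phi p) (phi q) ->
  touchable (circles f1 f2 f3 f4) C p q.
Proof.
assert (fl : forall z, phi z = phi p <-> z = p).
{ intros z. split; [|intros ->; auto].
  intros E. rewrite <- (phi_involutive z), E, phi_involutive; auto. }
intros (D & HD & Dp & Dq & T & U). exists (fun z => D (phi z)).
split; [apply circles_flip in HD; auto|]. do 2 (split; [auto|]). split.
- intros z. rewrite <- fl, <- (T (phi z)), phi_involutive. tauto.
- intros E HE Ep Eq TE z. apply circles_flip in HE.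
  rewrite <- (phi_involutive z) at 1.
  apply (U (fun z => E (phi z))); auto; rewrite ?phi_involutive; auto.
  intros w. rewrite (TE (phi w)), <- fl, phi_involutive. tauto.
Qed.

Lemma touchable_minus f1 f2 f3 f4 d1 d2 d3 d4 C p q :
  sh f1 d1 -> sh f2 d2 -> sh f3 d3 -> sh f4 d4 ->
  Cminus f1 f2 C -> C p -> ~ C q -> ~ parallel p q ->
  touchable (circles f1 f2 f3 f4) C p q.
Proof.
intros H1 H2 H3 H4 HC Cp Cq N.
apply Cminus_iff in HC. destruct HC as (k & V & S).
rewrite (S p) in Cp. rewrite (S q) in Cq.
destruct (touch_core f1 f2 d1 d2 k p q) as (k1 & V1 & P1 & Q1 & T & U); auto.
exists (on f1 f2 k1). split.
{ left. apply Cminus_iff. exists k1. split; auto. intros z; tauto. }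
split; [auto|split; [auto|split]].
- intros z. rewrite (S z). apply T.
- intros E [HE|HE] Ep Eq TE.
  + apply Cminus_iff in HE. destruct HE as (k2 & V2 & S2).
    rewrite <- (U k2); auto.
    * apply S2; auto.
    * apply S2; auto.
    * intros z Z Z2. apply TE. rewrite (S z), (S2 z). auto.
  + exfalso. apply Cplus_iff in HE. destruct HE as (k2 & V2 & S2).
    destruct (opposite_meet_again f1 f2 f3 f4 d1 d2 d3 d4 k k2 p) as (z & Nz & Z & Z2); auto.
    * apply S2; auto.
    * apply Nz, TE. rewrite (S z), (S2 z). auto.
Qed.

Theorem theorem4p1 (f1 f2 f3 f4 : R -> R) :
  strongly_hyperbolic f1 -> strongly_hyperbolic f2 ->
  strongly_hyperbolic f3 -> strongly_hyperbolic f4 ->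
  flat_minkowski_plane (fun D => Cminus f1 f2 D \/ Cplus f3 f4 D).
Proof.
intros SH1 SH2 SH3 SH4.
destruct (strongly_hyperbolic_sh _ SH1) as (d1 & H1).
destruct (strongly_hyperbolic_sh _ SH2) as (d2 & H2).
destruct (strongly_hyperbolic_sh _ SH3) as (d3 & H3).
destruct (strongly_hyperbolic_sh _ SH4) as (d4 & H4).
split; [|split].
- intros C [HC|HC].
  + apply Cminus_iff in HC. destruct HC as (k & V & S).
    exists (circ_fun f1 f2 k). split. eapply circ_fun_homeo; eauto.
    intros p. rewrite (S p). apply on_circ_fun.
  + apply Cplus_iff in HC. destruct HC as (k & V & S).
    exists (fun z => circ_fun f3 f4 k (negS1 z)). split.
    apply (homeo_comp _ _ (circ_fun_homeo _ _ _ _ _ H3 H4 V) negS1_homeo).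
    intros p. rewrite (S p). apply (on_circ_fun f3 f4 k (phi p)).
- intros p q r. apply (joinable_all f1 f2 f3 f4 d1 d2 d3 d4); auto.
- intros C p q [HC|HC] Cp Cq N.
  + apply (touchable_minus f1 f2 f3 f4 d1 d2 d3 d4); auto.
  + apply touchable_flip. apply (touchable_minus f3 f4 f1 f2 d3 d4 d1 d2); auto.
    * apply Cplus_iff in HC. destruct HC as (k & V & S). apply Cminus_iff. exists k.
      split; auto. intros z. rewrite (S (phi z)), phi_involutive. tauto.
    * rewrite phi_involutive; auto.
    * rewrite phi_involutive; auto.
    * rewrite parallel_flip; auto.
Qed.
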